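(* Let $F_n=\langle x_1,\dots,x_n\rangle$ be the free group of rank $n \geq 1$. The group $IO_n$ is $\mathrm{Out}(F_n)$-normally generated by the $\mathrm{Out}(F_n)$-classes of the automorphisms $$M_{ij}: x_i\mapsto x_jx_ix_j^{-1},\qquad M_{ijk}: x_i\mapsto x_i[x_j,x_k],$$ where $i,j,k\in\{1,\dots,n\}$ are distinct and $j<k$.
   Context: $IO_n\subset\mathrm{Out}(F_n)$ is the kernel of the action of $\mathrm{Out}(F_n)$ on $H_1(F_n;\mathbb{Z})=\mathbb{Z}^n$. The automorphisms $M_{ij}$ and $M_{ijk}$ are understood to fix $x_\ell$ for $\ell\ne i$. Convention: $[a,b]=aba^{-1}b^{-1}$. A subgroup $H \trianglelefteq G$ is $G$-normally generated by a subset $T\subset H$ if $H$ is generated by all $G$-conjugates of elements of $T$. *)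

(* Defs.v *)
From HB Require Import structures.
From mathcomp Require Import all_boot.
From mathcomp Require Import boolp classical_sets.

Set Implicit Arguments.
Unset Strict Implicit.
Unset Printing Implicit Defensive.

Local Open Scope classical_set_scope.
Local Open Scope quotient_scope.
Local Open Scope group_scope.

(* Not MathComp's [~ a, b], which is a^-1 b^-1 a b. *)
Definition commutator (G : groupType) (a b : G) : G := a * b * a^-1 * b^-1.

Definition is_subgroup (G : groupType) (H : set G) : Prop :=
  [/\ H 1, (forall x y, H x -> H y -> H (x * y)) & forall x, H x -> H x^-1].

Definition is_normal_subgroup (G : groupType) (H : set G) : Prop :=
  is_subgroup H /\ forall g x, H x -> H (g * x * g^-1).

Definition generated (G : groupType) (T : set G) : set G :=
  smallest (@is_subgroup G) T.

Definition conjugates (G : groupType) (T : set G) : set G :=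
  [set g * t * g^-1 | g in [set: G] & t in T].

Definition normally_generated_by (G : groupType) (H T : set G) : Prop :=
  [/\ is_normal_subgroup H, T `<=` H & H = generated (conjugates T)].

Lemma generated_subgroup (G : groupType) (T : set G) :
  is_subgroup (generated T).
Proof.
split=> [A [[]]//|x y hx hy A hA|x hx A hA].
  by case: (hA) => -[_ hM _] _; apply: hM; [exact: hx|exact: hy].
by case: (hA) => -[_ _ hV] _; apply: hV; exact: hx.
Qed.

Lemma generated_normal (G : groupType) (T : set G) :
  (forall g t, T t -> T (g * t * g^-1)) -> is_normal_subgroup (generated T).
Proof.
move=> TJ; split=> [|g x]; first exact: generated_subgroup.
have [g1 gM gV] := generated_subgroup T.
suff: generated T `<=` [set y | generated T (g * y * g^-1)] by move/(_ x).
apply: smallest_sub => [|t /(TJ g)]; last exact: sub_gen_smallest.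
split=> [|a b /= ha hb|a /= ha]; first by rewrite /= mulg1 mulgV.
  have -> : g * (a * b) * g^-1 = (g * a * g^-1) * (g * b * g^-1).
    by rewrite !mulgA mulgVK.
  exact: gM.
have -> : g * a^-1 * g^-1 = (g * a * g^-1)^-1 by rewrite !invgM invgK mulgA.
exact: gV.
Qed.

Record normal_subgroup (G : groupType) := NormalSubgroup {
  nset : set G;
  nsetP : is_normal_subgroup nset }.

Section Quotient.
Variables (G : groupType) (N : normal_subgroup G).

Definition cosetrel : rel G := fun x y => `[< nset N (x^-1 * y) >].

Fact cosetrel_refl : reflexive cosetrel.
Proof. by move=> x; apply/asboolP; rewrite mulVg; have [[]] := nsetP N. Qed.

Fact cosetrel_sym : symmetric cosetrel.
Proof.
have [[_ _ NV] _] := nsetP N.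
by move=> x y; apply/asboolP/asboolP => /NV; rewrite invgM invgK.
Qed.

Fact cosetrel_trans : transitive cosetrel.
Proof.
have [[_ NM _] _] := nsetP N.
move=> y x z /asboolP xy /asboolP yz; apply/asboolP.
by rewrite -[x^-1](mulgK y) -mulgA; apply: NM; rewrite ?mulgA.
Qed.

Canonical cosetrel_equiv :=
  EquivRel cosetrel cosetrel_refl cosetrel_sym cosetrel_trans.

Definition quotient_group := {eq_quot cosetrel_equiv}.
HB.instance Definition _ := Choice.on quotient_group.
HB.instance Definition _ := EqQuotient.on quotient_group.

Definition proj (x : G) : quotient_group := \pi x.

Lemma projP (x y : G) : proj x = proj y <-> nset N (x^-1 * y).
Proof.
rewrite /proj; split=> [/eqmodP/asboolP//|h].
by apply/eqmodP/asboolP.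
Qed.

Lemma repr_proj (u : quotient_group) : proj (repr u) = u.
Proof. exact: reprK. Qed.

Definition quot_one : quotient_group := proj 1.
Definition quot_mul (u v : quotient_group) : quotient_group :=
  proj (repr u * repr v).
Definition quot_inv (u : quotient_group) : quotient_group := proj (repr u)^-1.

Lemma quot_mulE x y : quot_mul (proj x) (proj y) = proj (x * y).
Proof.
have [[_ NM NV] NJ] := nsetP N.
have /projP hx := repr_proj (proj x); have /projP hy := repr_proj (proj y).
apply/projP; rewrite invgM.
set a := repr _ in hx *; set b := repr _ in hy *.
have -> : b^-1 * a^-1 * (x * y)
    = (b^-1 * y) * (y^-1 * (a^-1 * x) * y^-1^-1).
  by rewrite invgK !mulgA mulgK.
by apply: NM => //; apply: NJ.
Qed.

Lemma quot_invE x : quot_inv (proj x) = proj x^-1.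
Proof.
have [[_ NM NV] NJ] := nsetP N.
have /projP hx := repr_proj (proj x).
apply/projP; rewrite invgK; set a := repr _ in hx *.
have -> : a * x^-1 = x * (a^-1 * x)^-1 * x^-1 by rewrite invgM invgK !mulgA mulgV mul1g.
exact/NJ/NV.
Qed.

Fact quot_mulA : associative quot_mul.
Proof.
move=> u v w; rewrite -[u]repr_proj -[v]repr_proj -[w]repr_proj.
by rewrite !quot_mulE mulgA.
Qed.
Fact quot_1mul : left_id quot_one quot_mul.
Proof. by move=> u; rewrite -[u]repr_proj quot_mulE mul1g. Qed.
Fact quot_mul1 : right_id quot_one quot_mul.
Proof. by move=> u; rewrite -[u]repr_proj quot_mulE mulg1. Qed.
Fact quot_Vmul : left_inverse quot_one quot_inv quot_mul.
Proof. by move=> u; rewrite -[u]repr_proj quot_invE quot_mulE mulVg. Qed.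
Fact quot_mulV : right_inverse quot_one quot_inv quot_mul.
Proof. by move=> u; rewrite -[u]repr_proj quot_invE quot_mulE mulgV. Qed.

HB.instance Definition _ := isGroup.Build quotient_group
  quot_mulA quot_1mul quot_mul1 quot_Vmul quot_mulV.

Lemma projM : {morph proj : x y / x * y}.
Proof. by move=> x y; rewrite -quot_mulE. Qed.

Lemma proj1 : proj 1 = 1.
Proof. by []. Qed.

Lemma projV : {morph proj : x / x^-1}.
Proof. by move=> x; rewrite -quot_invE. Qed.

End Quotient.

Section Homology.
Variable G : groupType.

Definition commutators : set G :=
  [set commutator a b | a in [set: G] & b in [set: G]].

Fact derived_normal : is_normal_subgroup (generated commutators).
Proof.
apply: generated_normal => g _ [a _ [b _ <-]].
exists (g * a * g^-1) => //; exists (g * b * g^-1) => //.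
by rewrite /commutator !invgM !invgK !mulgA !mulgVK.
Qed.

Definition derived : normal_subgroup G := NormalSubgroup derived_normal.

(* H_1(G; Z) = G / [G, G], written multiplicatively. *)
Definition H1 := quotient_group derived.
HB.instance Definition _ := Group.on H1.

End Homology.

Record aut (G : groupType) := Aut {
  autfun :> G -> G;
  autinv : G -> G;
  autM : {morph autfun : x y / x * y};
  autK : cancel autfun autinv;
  autVK : cancel autinv autfun }.

Section Automorphisms.
Variable G : groupType.
Implicit Types f g h : aut G.

Lemma aut_ext f g : (forall x, f x = g x) -> f = g.
Proof.
case: f g => [f f' fM fK f'K] [g g' gM gK g'K] /= /funext fg.
move: fM fK f'K; rewrite fg => fM fK f'K.
have E : f' = g' by apply/funext => x; rewrite -{1}[x]g'K fK.
move: fK f'K; rewrite E => fK f'K.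
by congr Aut; exact: Prop_irrelevance.
Qed.

HB.instance Definition _ := gen_eqMixin (aut G).
HB.instance Definition _ := gen_choiceMixin (aut G).

Lemma autinvM f : {morph autinv f : x y / x * y}.
Proof. by move=> x y; apply: (can_inj (autK f)); rewrite autM !autVK. Qed.

Definition aut_one : aut G := @Aut G id id (fun _ _ => erefl)
  (fun _ => erefl) (fun _ => erefl).

Definition aut_inv f : aut G :=
  @Aut G (autinv f) f (autinvM f) (@autVK _ f) (@autK _ f).

Fact aut_compM f g : {morph f \o g : x y / x * y}.
Proof. by move=> x y /=; rewrite !autM. Qed.

Definition aut_mul f g : aut G :=
  @Aut G (f \o g) (autinv g \o autinv f) (aut_compM f g)
    (can_comp (@autK _ f) (@autK _ g)) (can_comp (@autVK _ g) (@autVK _ f)).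

Fact aut_mulA : associative aut_mul.
Proof. by move=> f g h; apply: aut_ext. Qed.
Fact aut_mul1f : left_id aut_one aut_mul.
Proof. by move=> f; apply: aut_ext. Qed.
Fact aut_mulf1 : right_id aut_one aut_mul.
Proof. by move=> f; apply: aut_ext. Qed.
Fact aut_mulVf : left_inverse aut_one aut_inv aut_mul.
Proof. by move=> f; apply: aut_ext => x; exact: autK. Qed.
Fact aut_mulfV : right_inverse aut_one aut_inv aut_mul.
Proof. by move=> f; apply: aut_ext => x; exact: autVK. Qed.

HB.instance Definition _ := isGroup.Build (aut G)
  aut_mulA aut_mul1f aut_mulf1 aut_mulVf aut_mulfV.

Lemma aut_mulE f g x : (f * g) x = f (g x).
Proof. by []. Qed.

Lemma aut1 f : f 1 = 1.
Proof. by apply: (@mulgI _ (f 1)); rewrite -autM !mulg1. Qed.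

Lemma autV f x : f x^-1 = (f x)^-1.
Proof. by apply: (@mulgI _ (f x)); rewrite -autM !mulgV aut1. Qed.

Fact inner_morph (g : G) : {morph (fun x => g * x * g^-1) : x y / x * y}.
Proof. by move=> x y; rewrite !mulgA mulgVK. Qed.
Fact inner_can (g : G) :
  cancel (fun x => g * x * g^-1) (fun x => g^-1 * x * g).
Proof. by move=> x; rewrite !mulgA mulVg mul1g mulgVK. Qed.
Fact inner_canV (g : G) :
  cancel (fun x => g^-1 * x * g) (fun x => g * x * g^-1).
Proof. by move=> x; rewrite !mulgA mulgV mul1g mulgK. Qed.

Definition inner_aut (g : G) : aut G :=
  Aut (inner_morph g) (inner_can g) (inner_canV g).

Fact inner_normal : is_normal_subgroup (range inner_aut).
Proof.
split; first split=> [|_ _ [a _ <-] [b _ <-]|_ [a _ <-]].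
- by exists 1 => //; apply: aut_ext => x /=; rewrite mul1g invg1 mulg1.
- by exists (a * b) => //; apply: aut_ext => x /=; rewrite invgM !mulgA.
- by exists a^-1 => //; apply: aut_ext => x /=; rewrite invgK.
move=> f _ [a _ <-]; exists (f a) => //; apply: aut_ext => x.
change (f a * x * (f a)^-1 = f (a * autinv f x * a^-1)).
by rewrite !autM autV autVK.
Qed.

Definition Inn : normal_subgroup (aut G) := NormalSubgroup inner_normal.

Definition Out := quotient_group Inn.
HB.instance Definition _ := Group.on Out.

Definition out_class (f : aut G) : Out := proj Inn f.

(* The action of Out(G) on H_1(G) is defined on representatives; out_actE
   below is its independence of the choice. *)
Definition out_act (phi : Out) (a : H1 G) : H1 G :=
  proj (derived G) ((repr phi : aut G) (repr a)).

Lemma aut_derived f x : nset (derived G) x -> nset (derived G) (f x).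
Proof.
have [d1 dM dV] := generated_subgroup (@commutators G).
suff: nset (derived G) `<=` [set y | nset (derived G) (f y)] by move/(_ x).
apply: smallest_sub => [|_ [a _ [b _ <-]] /=].
  split=> [|a b /= ha hb|a /= ha].
  - by rewrite /= aut1.
  - by rewrite autM; exact: dM.
  - by rewrite autV; exact: dV.
apply: sub_gen_smallest; exists (f a) => //; exists (f b) => //.
by rewrite /commutator !autM !autV.
Qed.

Lemma out_actE f x :
  out_act (out_class f) (proj (derived G) x) = proj (derived G) (f x).
Proof.
rewrite /out_act; set f' := repr _; set x' := repr _.
have [a _ /(congr1 (fun h : aut G => h x))] :
    nset Inn (f'^-1 * f) by apply/projP; exact: repr_proj.
rewrite aut_mulE /= => /(congr1 f'); rewrite autVK => <-.
have hx : nset (derived G) (x'^-1 * x) by apply/projP; exact: repr_proj.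
apply/projP; rewrite -autV -autM; apply: aut_derived.
have [[_ dM _] _] := nsetP (derived G).
have -> : x'^-1 * (a * x * a^-1) = (x'^-1 * x) * commutator x^-1 a.
  by rewrite /commutator invgK !mulgA mulgK.
by apply: dM => //; apply: sub_gen_smallest; exists x^-1 => //; exists a.
Qed.

Lemma out_classP phi : exists f, phi = out_class f.
Proof. by exists (repr phi); rewrite /out_class repr_proj. Qed.

Lemma out_classM : {morph out_class : f g / f * g}.
Proof. exact: projM. Qed.

Lemma out_act1 a : out_act 1 a = a.
Proof. by rewrite -[a]repr_proj; exact: (out_actE 1). Qed.

Lemma out_actA phi psi a : out_act (phi * psi) a = out_act phi (out_act psi a).
Proof.
have [f ->] := out_classP phi; have [g ->] := out_classP psi.
by rewrite -out_classM -[a]repr_proj !out_actE.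
Qed.

Lemma out_actM phi : {morph out_act phi : a b / a * b}.
Proof.
move=> a b; have [f ->] := out_classP phi.
have H1M x y :
    proj (derived G) x * proj (derived G) y = proj (derived G) (x * y) :> H1 G.
  by rewrite projM.
by rewrite -[a]repr_proj -[b]repr_proj H1M !out_actE autM H1M.
Qed.

Definition out_act_kernel : set Out := [set phi | forall a, out_act phi a = a].

End Automorphisms.

Section FreeGroup.
Variable X : choiceType.

(* The free group on X is the set of reduced words in letters (x, b), where
   (x, false) stands for x and (x, true) for x^-1. *)
Definition letter := (X * bool)%type.
HB.instance Definition _ := Choice.on letter.
Implicit Types (a b : letter) (u v w : seq letter).

Definition linv a : letter := (a.1, ~~ a.2).

Definition reduced w : bool := sorted (fun a b => b != linv a) w.

Definition cons_letter a w :=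
  if w is b :: w' then if b == linv a then w' else a :: w else [:: a].

Definition word_mul u v := foldr cons_letter v u.
Definition word_inv u := rev (map linv u).

Lemma linvK : involutive linv.
Proof. by case=> x b; rewrite /linv /= negbK. Qed.

Lemma cons_letter_reduced a w : reduced w -> reduced (cons_letter a w).
Proof.
case: w => [//|b w] /= rw; case: eqP => [_|/eqP nab]; first exact: path_sorted rw.
by rewrite /= nab.
Qed.

Lemma word_mul_reduced u v : reduced v -> reduced (word_mul u v).
Proof. by move=> rv; elim: u => //= a u; apply: cons_letter_reduced. Qed.

Lemma word_inv_reduced u : reduced u -> reduced (word_inv u).
Proof.
rewrite /reduced /word_inv rev_sorted sorted_map.
apply: sub_sorted => a b /=; apply: contraNN => /eqP->.
by rewrite linvK.
Qed.

Lemma cons_letterK a w :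
  reduced w -> cons_letter (linv a) (cons_letter a w) = w.
Proof.
case: w => [|b w] /=; first by rewrite linvK eqxx.
case: eqP => [->|_ _] /=; last by rewrite linvK eqxx.
by case: w => [//|c w] /= /andP[/negPf -> _].
Qed.

Lemma word_mul_cons a u w : reduced w ->
  word_mul (cons_letter a u) w = cons_letter a (word_mul u w).
Proof.
case: u => [//|b u] rw /=; case: eqP => [->|//].
by have := cons_letterK (linv a) (word_mul_reduced u rw); rewrite linvK.
Qed.

Lemma word_mulA u v w : reduced w ->
  word_mul u (word_mul v w) = word_mul (word_mul u v) w.
Proof. by move=> rw; elim: u => //= a u ->; rewrite word_mul_cons. Qed.

Lemma word_mul1 u : reduced u -> word_mul u [::] = u.
Proof.
elim: u => //= a u IHu ru; rewrite (IHu (path_sorted ru)).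
by case: u ru {IHu} => //= b u /andP[/negPf->].
Qed.

Lemma word_mulV u : reduced u -> word_mul (word_inv u) u = [::].
Proof.
elim: u => //= a u IHu ru; rewrite /word_inv /= rev_cons.
by rewrite /word_mul foldr_rcons /= linvK eqxx; apply: IHu; exact: path_sorted ru.
Qed.

Lemma word_invK u : word_inv (word_inv u) = u.
Proof. by rewrite /word_inv map_rev revK mapK //; exact: linvK. Qed.

Record free_group := FreeGroup { word :> seq letter; _ : reduced word }.
HB.instance Definition _ := [isSub for word].
HB.instance Definition _ := [Choice of free_group by <:].

Implicit Types x y z : free_group.

Definition fg_one : free_group := @FreeGroup [::] isT.
Definition fg_mul x y : free_group :=
  FreeGroup (word_mul_reduced (word x) (valP y)).
Definition fg_inv x : free_group := FreeGroup (word_inv_reduced (valP x)).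

Fact fg_mulA : associative fg_mul.
Proof. by move=> x y z; apply: val_inj; exact: word_mulA (valP z). Qed.
Fact fg_1mul : left_id fg_one fg_mul.
Proof. by move=> x; apply: val_inj. Qed.
Fact fg_mul1 : right_id fg_one fg_mul.
Proof. by move=> x; apply: val_inj; exact: word_mul1 (valP x). Qed.
Fact fg_Vmul : left_inverse fg_one fg_inv fg_mul.
Proof. by move=> x; apply: val_inj; exact: word_mulV (valP x). Qed.
Fact fg_mulV : right_inverse fg_one fg_inv fg_mul.
Proof.
move=> x; apply: val_inj; rewrite /= -{1}[word x]word_invK.
exact: word_mulV (valP (fg_inv x)).
Qed.

HB.instance Definition _ := isGroup.Build free_group
  fg_mulA fg_1mul fg_mul1 fg_Vmul fg_mulV.

Definition fgen (i : X) : free_group := @FreeGroup [:: (i, false)] isT.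

Section Lift.
Variables (G : groupType) (f : X -> G).

Definition letter_val a : G := if a.2 then (f a.1)^-1 else f a.1.

Definition fg_lift x : G := foldr (fun a g => letter_val a * g) 1 (word x).

Lemma letter_valV a : letter_val (linv a) = (letter_val a)^-1.
Proof. by case: a => i [] /=; rewrite /letter_val /= ?invgK. Qed.

Lemma fg_liftM : {morph fg_lift : x y / x * y}.
Proof.
case=> u ru [v rv]; rewrite /fg_lift /= {ru}.
elim: u => [|a u IHu] /=; first by rewrite mul1g.
rewrite -mulgA -IHu; case: (word_mul u v) => [//|b w] /=.
by case: eqP => [->|//] /=; rewrite letter_valV mulVKg.
Qed.

Lemma fg_lift_gen i : fg_lift (fgen i) = f i.
Proof. by rewrite /fg_lift /= mulg1. Qed.

End Lift.

Lemma fg_morph_eq (G : groupType) (f g : free_group -> G) :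
  {morph f : x y / x * y} -> {morph g : x y / x * y} ->
  (forall i, f (fgen i) = g (fgen i)) -> f =1 g.
Proof.
move=> fM gM fg.
have m1 (h : free_group -> G) : {morph h : x y / x * y} -> h 1 = 1.
  by move=> hM; apply: (@mulgI _ (h 1)); rewrite -hM !mulg1.
have mV (h : free_group -> G) :
    {morph h : x y / x * y} -> forall x, h x^-1 = (h x)^-1.
  by move=> hM x; apply: (@mulgI _ (h x)); rewrite -hM !mulgV m1.
case=> u; elim: u => [|[i b] u IHu] ru.
  have -> : FreeGroup ru = 1 by apply: val_inj.
  by rewrite !m1.
have ru' := path_sorted ru.
have -> : FreeGroup ru =
    (if b then (fgen i)^-1 else fgen i) * FreeGroup ru'.
  apply: val_inj; case: b {IHu} ru => /=;
    by case: (u) => //= c v /andP[/negPf->].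
by rewrite fM gM IHu; case: b {ru}; rewrite ?mV // fg.
Qed.

End FreeGroup.

Definition IO (n : nat) : set (Out (free_group 'I_n)) :=
  @out_act_kernel (free_group 'I_n).

Section Magnus.
Variable n : nat.
Notation F := (free_group 'I_n).
Notation x i := (fgen (i : 'I_n)).
Implicit Types i j k l : 'I_n.

Definition subst_gen i (w : F) : F -> F :=
  fg_lift (fun l => if l == i then w else x l).

Lemma subst_genM i w : {morph subst_gen i w : u v / u * v}.
Proof. exact: fg_liftM. Qed.

Lemma subst_gen_i i w : subst_gen i w (x i) = w.
Proof. by rewrite /subst_gen fg_lift_gen eqxx. Qed.

Lemma subst_gen_l i w l : l != i -> subst_gen i w (x l) = x l.
Proof. by move=> /negPf li; rewrite /subst_gen fg_lift_gen li. Qed.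

Lemma subst_genV i w u : subst_gen i w u^-1 = (subst_gen i w u)^-1.
Proof.
have s1 : subst_gen i w 1 = 1 by [].
by apply: (@mulgI _ (subst_gen i w u)); rewrite -subst_genM !mulgV.
Qed.

Lemma subst_genK i v w :
  subst_gen i v w = x i -> cancel (subst_gen i w) (subst_gen i v).
Proof.
move=> vw u; rewrite -[RHS]/(id u).
apply: (@fg_morph_eq _ _ (subst_gen i v \o subst_gen i w) id) => //.
  by move=> a b /=; rewrite !subst_genM.
move=> l /=; have [->|li] := eqVneq l i; first by rewrite subst_gen_i.
by rewrite !subst_gen_l.
Qed.

Section Mij.
Variables (i j : 'I_n) (ij : i != j).

Definition Mij_fun : F -> F := subst_gen i (x j * x i * (x j)^-1).
Definition Mij_inv : F -> F := subst_gen i ((x j)^-1 * x i * x j).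

Fact Mij_can : cancel Mij_fun Mij_inv.
Proof.
apply: subst_genK; rewrite !subst_genM subst_genV subst_gen_i.
by rewrite subst_gen_l 1?eq_sym // !mulgA mulgV mul1g mulgK.
Qed.

Fact Mij_canV : cancel Mij_inv Mij_fun.
Proof.
apply: subst_genK; rewrite !subst_genM subst_genV subst_gen_i.
by rewrite subst_gen_l 1?eq_sym // !mulgA mulVg mul1g mulgVK.
Qed.

Definition Mij : aut F :=
  @Aut F Mij_fun Mij_inv (@subst_genM _ _) Mij_can Mij_canV.

End Mij.

Section Mijk.
Variables (i j k : 'I_n) (ij : i != j) (ik : i != k).

Definition Mijk_fun : F -> F := subst_gen i (x i * commutator (x j) (x k)).
Definition Mijk_inv : F -> F :=
  subst_gen i (x i * (commutator (x j) (x k))^-1).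

Lemma subst_gen_comm w :
  subst_gen i w (commutator (x j) (x k)) = commutator (x j) (x k).
Proof.
by rewrite /commutator !(subst_genM, subst_genV) !subst_gen_l // eq_sym.
Qed.

Fact Mijk_can : cancel Mijk_fun Mijk_inv.
Proof. by apply: subst_genK; rewrite subst_genM subst_gen_i subst_gen_comm mulgVK. Qed.

Fact Mijk_canV : cancel Mijk_inv Mijk_fun.
Proof.
by apply: subst_genK; rewrite subst_genM subst_genV subst_gen_i subst_gen_comm mulgK.
Qed.

Definition Mijk : aut F :=
  @Aut F Mijk_fun Mijk_inv (@subst_genM _ _) Mijk_can Mijk_canV.

End Mijk.

Definition magnus_generators : set (Out F) :=
  [set phi | exists (i j : 'I_n) (ij : i != j), phi = out_class (Mij ij)]
  `|` [set phi | exists (i j k : 'I_n) (ij : i != j) (ik : i != k),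
         (j < k)%N /\ phi = out_class (Mijk ij ik)].

End Magnus.

Arguments IO : clear implicits.
Arguments magnus_generators : clear implicits.

(* Main.v *)
From HB Require Import structures.
From mathcomp Require Import all_boot all_order all_fingroup all_algebra.
From mathcomp Require Import boolp classical_sets.
From mathcomp Require Import zify.
Require Import Defs.

(** Let N be the preimage in Aut(F_n) of the normal closure of the Magnus
    generators.  Since the generators act trivially on H_1, the content of the
    theorem is that an automorphism f acting trivially on H_1 lies in N.  Two
    classical facts give this.

    The first is Nielsen's theorem ([Nielsen_generation]): Aut(F_n) is generated
    by the transvections x_j |-> x_j x_i, the sign changes and the permutations
    of the basis.  Slides x_a |-> x_a x_c that shorten the tuple of images of the
    basis, or keep its total length and lower a tie-breaking weight, are applied
    as long as possible.  When no slide helps, less than the whole of each letter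
    is cancelled in every product of consecutive letters ([cancel_lt]), so f does
    not shorten words ([len_im]), and f^-1, which sends generators to words of
    length one, is a signed permutation.

    The second is that GL_n(Z) is presented by these generators and the
    relations of [elementary_relations]: in a group where the relations hold and
    which acts compatibly on Z^n, a product of generators that acts trivially is
    1 ([elementary_faithful]).  The proof removes the basis vectors one by one.
    For a basis vector e_d let H be the subgroup generated by the generators that
    fix e_d.  The subtractive Euclidean algorithm v_i := v_i - v_j, for
    v_i >= v_j > 0, brings a vector v >= 0 to a multiple of some e_m, and reading
    it backwards attaches to v a coset of H.  The algorithm is not
    deterministic, but any two of its steps can be joined, and the resulting
    equalities of cosets are the Steinberg relations ([move_confluent]).
    So the coset depends only on v, and it is equivariant in v after extension
    to signed vectors.  A product g of generators that fixes e_d hence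
    satisfies gH = H, that is g is in H ([fix_stab]).  Finally an element of H is
    u h with u a product of tr d j and h a product of generators on the remaining
    indices; if it acts trivially then so do u and h, u is 1 because the tr d j
    commute, and the induction applies to h.

    The relations hold modulo N ([elementary_relations_mod_magnus]): those that
    fail in Aut(F_n) itself fail by one partial conjugation M_ij or one M_ijk.
    Hence the class of f in Aut(F_n) / N is a product of generators that acts
    trivially on Z^n, so it is 1. *)

Set Implicit Arguments.
Unset Strict Implicit.
Unset Printing Implicit Defensive.

Import Order.TTheory GRing.Theory Num.Theory.
Local Open Scope group_scope.

(** * A presentation of GL_n(Z) *)

(** [tr i j] stands for the elementary matrix 1 + E_ij, [sg e] for the diagonal
    matrix with -1 at the indices where e holds, [pm s] for the matrix
    e_m |-> e_(s m).  [tr_swap] is the usual formula expressing a signed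
    transposition through three elementary matrices.  In [pm_mul] the order
    is reversed because permutations are composed from left to right. *)
Record elementary_relations (I : finType) (G : groupType)
    (tr : I -> I -> G) (sg : (I -> bool) -> G) (pm : {perm I} -> G) : Prop :=
  ElementaryRelations {
    tr_comm : forall i j k l, i != j -> k != l -> j != k -> i != l ->
      tr i j * tr k l = tr k l * tr i j;
    tr_chain : forall i j l, i != j -> j != l -> i != l ->
      tr i j * tr j l = tr j l * (tr i j * tr i l);
    tr_swap : forall i j, i != j ->
      tr j i = tr i j * (sg (pred1 i) * (pm (tperm i j) * tr i j));
    sg_mul : forall e e', sg e * sg e' = sg (fun l => e l (+) e' l);
    sg_tr : forall e i j, i != j ->
      sg e * tr i j = (if e i (+) e j then (tr i j)^-1 else tr i j) * sg e;
    pm_mul : forall s t, pm s * pm t = pm (t * s);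
    pm_sg : forall s e, pm s * sg e = sg (fun l => e (s^-1 l)) * pm s;
    pm_tr : forall s i j, i != j -> pm s * tr i j = tr (s i) (s j) * pm s }.

Inductive products (G : groupType) (P : G -> Prop) : G -> Prop :=
| products1 : products P 1
| productsM a g : P a -> products P g -> products P (a * g).

Inductive elementary (I : finType) (G : groupType) (tr : I -> I -> G)
    (sg : (I -> bool) -> G) (pm : {perm I} -> G) (D : {set I}) : G -> Prop :=
| elementary_tr i j : i \in D -> j \in D -> i != j ->
    elementary tr sg pm D (tr i j)
| elementary_sg (e : I -> bool) : (forall l, e l -> l \in D) ->
    elementary tr sg pm D (sg e)
| elementary_pm s : perm_on D s -> elementary tr sg pm D (pm s).

Lemma perm_on_tperm (I : finType) (D : {set I}) i j :
  i \in D -> j \in D -> perm_on D (tperm i j).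
Proof.
move=> iD jD; apply/fintype.subsetP => l; rewrite inE.
by case: tpermP => [-> //|-> //|_ _]; rewrite eqxx.
Qed.

Definition trv (I : finType) (i j : I) (v : I -> int) : I -> int :=
  fun l => if l == i then (v l + v j)%R else v l.
Definition sgv (I : finType) (e : I -> bool) (v : I -> int) : I -> int :=
  fun l => if e l then (- v l)%R else v l.
Definition pmv (I : finType) (s : {perm I}) (v : I -> int) : I -> int :=
  fun l => v (s^-1 l).
Definition deltav (I : finType) (d : I) : I -> int :=
  fun l => Posz (l == d).

Record elementary_action (I : finType) (G : groupType)
    (tr : I -> I -> G) (sg : (I -> bool) -> G) (pm : {perm I} -> G)
    (rho : G -> (I -> int) -> (I -> int)) : Prop := ElementaryAction {
  rho1 : forall v, rho 1 v = v;
  rhoM : forall g h v, rho (g * h) v = rho g (rho h v);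
  rho_tr : forall i j, i != j -> rho (tr i j) = trv i j;
  rho_sg : forall e, rho (sg e) = sgv e;
  rho_pm : forall s, rho (pm s) = pmv s }.

(** * The coset attached to a vector by the Euclidean algorithm *)

Section EuclidSection.
Variables (I : finType) (G : groupType).
Variables (tr : I -> I -> G) (sg : (I -> bool) -> G) (pm : {perm I} -> G).
Hypothesis rel : elementary_relations tr sg pm.
(* X plays the role of the set of cosets of the subgroup H generated by the
   generators fixing e_d, and x0 that of H itself. *)
Variables (X : Type) (op : G -> X -> X).
Hypothesis op1 : forall x, op 1 x = x.
Hypothesis opM : forall g h x, op (g * h) x = op g (op h x).
Variables (D : {set I}) (d : I) (dD : d \in D) (x0 : X).
Hypothesis x0_tr : forall i j, i \in D -> j \in D -> i != j -> j != d ->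
  op (tr i j) x0 = x0.
Hypothesis x0_sg : forall e : I -> bool, (forall l, e l -> l \in D) -> ~~ e d ->
  op (sg e) x0 = x0.
Hypothesis x0_pm : forall s, perm_on D s -> s d = d -> op (pm s) x0 = x0.

Implicit Types (v : I -> nat) (i j k l : I) (s t : {perm I}) (x y : X).

Definition addv i j v := fun l => if l == i then v l + v j else v l.
Definition subv i j v := fun l => if l == i then v l - v j else v l.
Definition weight v := \sum_l v l.

(** [reached v x] says that x is a coset obtained from v >= 0 by some run of the
    subtractive Euclidean algorithm, read backwards.  The relation ends at the
    multiples of the vectors e_m, to which pm s x0 with s d = m is attached, so
    v need not be primitive; the zero vector is never reached. *)
Inductive reached : (I -> nat) -> X -> Prop :=
| reached_axis s v : perm_on D s -> 0 < v (s d) ->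
    (forall l, l != s d -> v l = 0) -> reached v (op (pm s) x0)
| reached_tr i j v x : i \in D -> i != j -> 0 < v j ->
    reached v x -> reached (addv i j v) (op (tr i j) x).

Lemma addvK i j v : i != j -> subv i j (addv i j v) = v.
Proof.
move=> ij; apply/funext => l; rewrite /subv /addv.
by rewrite [j == i]eq_sym (negPf ij); case: eqP => // ->; rewrite addnK.
Qed.

Lemma subvK i j v : i != j -> v j <= v i -> addv i j (subv i j v) = v.
Proof.
move=> ij le; apply/funext => l; rewrite /subv /addv.
by rewrite [j == i]eq_sym (negPf ij); case: eqP => // ->; rewrite subnK.
Qed.

Lemma subv_le i j v l : subv i j v l <= v l.
Proof. by rewrite /subv; case: ifP => // _; exact: leq_subr. Qed.

Lemma weight_subv i j v : i != j -> 0 < v j <= v i ->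
  weight (subv i j v) < weight v.
Proof.
move=> ij /andP[vj le]; rewrite /weight (bigD1 i) //= [ltnRHS](bigD1 i) //=.
rewrite {1}/subv eqxx (eq_bigr v) => [|l /negPf li]; last by rewrite /subv li.
by rewrite ltn_add2r; lia.
Qed.

Lemma reached_supp v x l : reached v x -> 0 < v l -> l \in D.
Proof.
move=> r; elim: r l => {v x} [s v sD _ v0|i j v x iD ij vj _ IH] l.
  have [->|/v0-> //] := eqVneq l (s d); first by rewrite perm_closed.
by rewrite /addv; case: eqP => [-> //|_]; apply: IH.
Qed.

Lemma reached_pm t v x : perm_on D t -> reached v x ->
  reached (fun l => v (t^-1 l)) (op (pm t) x).
Proof.
move=> tD; elim=> {v x} [s v sD vs v0|i j v x iD ij vj _ IH].
  rewrite -opM (pm_mul rel); apply: reached_axis; first exact: perm_onM.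
    by rewrite permM permK.
  move=> l; rewrite permM => ne; apply: v0; apply: contra_neq ne => <-.
  by rewrite permKV.
rewrite -opM (pm_tr rel) // opM.
have -> : (fun l => addv i j v (t^-1 l)) = addv (t i) (t j) (fun l => v (t^-1 l)).
  by apply/funext => l; rewrite /addv permK -(inj_eq (@perm_inj _ t)) permKV.
by apply: reached_tr; rewrite ?perm_closed ?permK // (inj_eq perm_inj).
Qed.

(** A run of the algorithm never uses a coordinate which is zero at its start,
    so a change of sign there commutes with all the steps and fixes x0. *)
Lemma reached_sg (e : I -> bool) v x : (forall l, e l -> l \in D) ->
  (forall l, e l -> v l = 0) -> reached v x -> op (sg e) x = x.
Proof.
move=> eD ev r; elim: r e eD ev => {v x}.
  move=> s v sD vs v0 e eD ev; rewrite -opM.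
  have -> : sg e * pm s = pm s * sg (fun l => e (s l)).
    by rewrite (pm_sg rel); congr (sg _ * _); apply/funext => l; rewrite permKV.
  rewrite opM x0_sg // => [l /eD|]; first by rewrite perm_closed.
  by apply: contraTN vs => /ev->.
move=> i j v x iD ij vj _ IH e eD ev.
have ej : e j = false.
  by apply/negbTE; apply: contraTN vj => /ev; rewrite /addv eq_sym (negPf ij) => ->.
have ei : e i = false.
  by apply/negbTE/negP => /ev; rewrite /addv eqxx; lia.
rewrite -opM (sg_tr rel) // ei ej opM IH // => l el.
by have := ev l el; rewrite /addv; case: eqP el => // ->; rewrite ei.
Qed.

(** The matrix tr i j fixes v when v j = 0; the attached coset must be fixed as
    well.  Pushing tr i j through a step tr k l produces only tr i j and, when
    i = l, the matrix tr k j, whose column index is again j. *)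
Lemma reached_tr0 i j v x : i \in D -> j \in D -> i != j -> v j = 0 ->
  reached v x -> op (tr i j) x = x.
Proof.
move=> iD jD ij vj0 r; elim: r i j iD jD ij vj0 => {v x}.
  move=> s v sD vs v0 i j iD jD ij vj0; rewrite -opM.
  have -> : tr i j * pm s = pm s * tr (s^-1 i) (s^-1 j).
    by rewrite (pm_tr rel) ?permKV // (inj_eq perm_inj).
  have sV a : (s^-1 a \in D) = (a \in D) by rewrite -(perm_closed _ sD) permKV.
  rewrite opM x0_tr ?sV // ?(inj_eq perm_inj) //.
  by apply: contraTneq vs => <-; rewrite permKV vj0.
move=> k l v x kD kl vl _ IH i j iD jD ij.
rewrite /addv; case: eqP => [_|/eqP jk vj0]; first by lia.
have fix_ i' : i' \in D -> i' != j -> op (tr i' j) x = x by move=> *; apply: IH.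
have [il|il] := eqVneq i l; last by rewrite -opM (tr_comm rel) // opM fix_.
subst l; rewrite -{2}(fix_ i) // -[RHS]opM (tr_chain rel) //; last by rewrite eq_sym.
by rewrite !opM !fix_ // eq_sym.
Qed.

(** When v j = 0 this is not a step of the algorithm, but then neither the
    vector nor the coset changes. *)
Lemma reached_addv i j v x : i \in D -> j \in D -> i != j ->
  reached v x -> reached (addv i j v) (op (tr i j) x).
Proof.
move=> iD jD ij r; have [vj0|vj] := posnP (v j); last exact: reached_tr.
rewrite (reached_tr0 _ _ _ vj0 r) //.
suff -> : addv i j v = v by [].
by apply/funext => l; rewrite /addv vj0 addn0 if_same.
Qed.

Lemma reached_ex v m : (forall l, 0 < v l -> l \in D) -> 0 < v m ->
  exists x, reached v x.
Proof.
have [N] := ubnP (weight v); elim: N v m => // N IH v m wv vD vm.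
case: (pselect (forall l, l != m -> v l = 0)) => [v0|].
  exists (op (pm (tperm d m)) x0).
  by apply: reached_axis; rewrite ?tpermL // perm_on_tperm // vD.
move=> /existsNP[l] /not_implyP[lm /eqP]; rewrite -lt0n => vl.
wlog le : m l vm lm vl / v l <= v m.
  move=> H; have [le|/ltnW le] := leqP (v l) (v m); first exact: (H m l).
  by apply: (H l m) => //; rewrite eq_sym.
have ml : m != l by rewrite eq_sym.
have [x r] : exists x, reached (subv m l v) x.
  apply: (IH _ l).
  - by have := @weight_subv m l v ml; rewrite vl le => /(_ isT); lia.
  - by move=> k sk; apply: vD; apply: leq_trans sk (subv_le _ _ _ _).
  - by rewrite /subv (negPf lm).
exists (op (tr m l) x); rewrite -(subvK ml le).
by apply: reached_tr => //; rewrite ?vD // /subv (negPf lm).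
Qed.

(** [move i j v x]: some run starting at v with the step v_i := v_i - v_j
    attaches x to v. *)
Definition move i j v x := [/\ i \in D, i != j, 0 < v j <= v i &
  exists2 y, reached (subv i j v) y & x = op (tr i j) y].

Lemma reached_inv v x : reached v x ->
  (exists s, [/\ perm_on D s, 0 < v (s d), forall l, l != s d -> v l = 0 &
     x = op (pm s) x0]) \/ exists i j, move i j v x.
Proof.
case=> {v x} [s v sD vs v0|i j v x iD ij vj r]; first by left; exists s.
right; exists i, j; split=> //.
  by rewrite /addv eqxx eq_sym (negPf ij) vj; lia.
by exists x; rewrite ?addvK.
Qed.

(** The diamonds of the Euclidean algorithm: two steps starting at v attach the
    same coset, provided the coset is unique for all smaller vectors. *)
Section Confluence.
Variable v : I -> nat.
Hypothesis uniq_below : forall v', weight v' < weight v ->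
  forall x y, reached v' x -> reached v' y -> x = y.
Hypothesis vD : forall l, 0 < v l -> l \in D.

Lemma move_ex i j : i != j -> 0 < v j <= v i -> exists x, move i j v x.
Proof.
move=> ij /andP[vj le].
have [||y r] := @reached_ex (subv i j v) j.
- by move=> l sl; apply: vD; apply: leq_trans sl (subv_le _ _ _ _).
- by rewrite /subv eq_sym (negPf ij).
by exists (op (tr i j) y); split; rewrite ?vj ?vD //; [lia|exists y].
Qed.

Lemma move_comm i j k l x y : i != k -> i != l -> j != k ->
  move i j v x -> move k l v y -> x = y.
Proof.
move=> ik il jk [iD ij vij [x' rx ->]] [kD kl vkl [y' ry ->]].
have ki : k != i by rewrite eq_sym.
have [li ji lk] : [/\ l != i, j != i & l != k] by rewrite !(eq_sym l) (eq_sym j).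
have kj : k != j by rewrite eq_sym.
pose u := subv k l (subv i j v).
have [z rz] : exists z, reached u z.
  apply: (@reached_ex _ j).
    move=> a ua; apply: vD; apply: leq_trans ua _.
    exact: leq_trans (subv_le _ _ _ _) (subv_le _ _ _ _).
  by rewrite /u /subv (negPf jk) (negPf ji); case/andP: vij.
have Ex : addv k l u = subv i j v.
  by rewrite subvK // /subv (negPf li) (negPf ki); case/andP: vkl.
have Ey : addv i j u = subv k l v.
  apply/funext => a; rewrite /addv /u /subv (negPf jk) (negPf ji).
  rewrite (negPf li); case: eqP => [->|//]; rewrite (negPf ik).
  by case/andP: vij => _ /subnK.
have lD : l \in D by case/andP: vkl => /vD.
have jD : j \in D by case/andP: vij => /vD.
rewrite (uniq_below (weight_subv ij vij) rx (y := op (tr k l) z)); last first.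
  by rewrite -Ex; apply: reached_addv.
rewrite (uniq_below (weight_subv kl vkl) ry (y := op (tr i j) z)); last first.
  by rewrite -Ey; apply: reached_addv.
by rewrite -!opM (tr_comm rel).
Qed.

(** The steps (i,j) and (j,l) do not commute: after v_j := v_j - v_l, the vector
    obtained by performing both is reached by the two steps (i,j) and (i,l).
    This is the Steinberg relation [tr_chain].  The intermediate value of v_j
    may be zero, which is why [reached_addv] allows it. *)
Lemma move_chain i j l x y : i != l -> move i j v x -> move j l v y -> x = y.
Proof.
move=> il [iD ij vij [x' rx ->]] [jD jl vjl [y' ry ->]].
have [li ji lj] : [/\ l != i, j != i & l != j] by rewrite !(eq_sym l) (eq_sym j).
pose u := subv j l (subv i j v).
have lD : l \in D by case/andP: vjl => /vD.
have [z rz] : exists z, reached u z.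
  apply: (@reached_ex _ l).
    move=> a ua; apply: vD; apply: leq_trans ua _.
    exact: leq_trans (subv_le _ _ _ _) (subv_le _ _ _ _).
  by rewrite /u /subv (negPf li) (negPf lj); case/andP: vjl.
have Ex : addv j l u = subv i j v.
  by rewrite subvK // /subv (negPf li) (negPf ji); case/andP: vjl.
have Ey : addv i j (addv i l u) = subv j l v.
  apply/funext => a; rewrite /addv /u /subv (negPf ji) (negPf li) (negPf lj).
  case: eqP => [->|//]; rewrite (negPf ij) eqxx.
  by case/andP: vij => _ vij; case/andP: vjl => _ vjl; lia.
rewrite (uniq_below (weight_subv ij vij) rx (y := op (tr j l) z)); last first.
  by rewrite -Ex; apply: reached_addv.
rewrite (uniq_below (weight_subv jl vjl) ry
           (y := op (tr i j) (op (tr i l) z))); last first.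
  by rewrite -Ey; apply: reached_addv => //; apply: reached_addv.
by rewrite -[LHS]opM (tr_chain rel) // !opM.
Qed.

(** Here v_i = v_j, and the two results differ by the transposition of i and j
    together with a change of sign of a zero coordinate. *)
Lemma move_swap i j x y : move i j v x -> move j i v y -> x = y.
Proof.
move=> [iD ij vij [x' rx ->]] [jD ji vji [y' ry ->]].
have vv : v i = v j by lia.
have E : subv i j v = fun l => subv j i v ((tperm i j)^-1 l).
  apply/funext => l; rewrite tpermV /subv.
  case: tpermP => [->|->|/eqP/negPf-> /eqP/negPf-> //].
    by rewrite !eqxx vv.
  by rewrite (negPf ij) (negPf ji).
have tD := perm_on_tperm iD jD.
have r := reached_pm tD ry; rewrite -E in r.
have y0 : op (tr i j) y' = y'.
  by apply: (reached_tr0 iD jD ij _ ry); rewrite /subv eqxx vv subnn.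
have s0 : op (sg (pred1 i)) (op (pm (tperm i j)) y') = op (pm (tperm i j)) y'.
  apply: (reached_sg _ _ r) => l /= /eqP-> //.
  by rewrite /subv eqxx vv subnn.
rewrite (tr_swap rel ij) !opM y0 s0.
by congr op; apply: uniq_below r; first exact: weight_subv.
Qed.

(** Subtracting both v_j and v_l from v_i may be impossible; the third step
    v_j := v_j - v_l is compatible with either of them. *)
Lemma move_join i j l x y : j != l -> v l <= v j ->
  move i j v x -> move i l v y -> x = y.
Proof.
move=> jl le mx my; have [_ ij vij _] := mx; have [_ il vil _] := my.
have [|z mz] := @move_ex j l jl; first by case/andP: vil => ->.
rewrite (move_chain il mx mz); symmetry.
by apply: (move_comm _ _ _ my mz); rewrite // eq_sym.
Qed.

Lemma move_confluent i j k l x y : move i j v x -> move k l v y -> x = y.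
Proof.
move=> mx my; have [ik|ik] := eqVneq i k.
  subst k; have [jl|jl] := eqVneq j l.
    subst l; case: mx my => [_ ij vij [x' rx ->]] [_ _ _ [y' ry ->]].
    by rewrite (uniq_below (weight_subv ij vij) rx ry).
  have [le|/ltnW le] := leqP (v l) (v j); first exact: (move_join jl le mx my).
  by symmetry; apply: (move_join _ le my mx); rewrite eq_sym.
have [il|il] := eqVneq i l.
  subst l; have [jk|jk] := eqVneq j k; first by subst k; apply: (move_swap mx my).
  by symmetry; apply: (move_chain _ my mx); rewrite eq_sym.
have [jk|jk] := eqVneq j k; first by subst k; apply: (move_chain il mx my).
exact: (move_comm ik il jk mx my).
Qed.

End Confluence.

Lemma reached_uniq v x y : reached v x -> reached v y -> x = y.
Proof.
have [N] := ubnP (weight v); elim: N v x y => // N IH v x y wv rx ry.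
have no_move s i j z : (forall l, l != s d -> v l = 0) -> ~ move i j v z.
  move=> v0 [_ ij /andP[vj le] _].
  have js : j = s d by apply/eqP; apply: contraTT vj => /v0->.
  by have := v0 i; rewrite -js => /(_ ij); lia.
case: (reached_inv rx) (reached_inv ry) => [[s [sD vs v0 ->]]|[i [j mx]]].
  case=> [[t [tD vt v0' ->]]|[i [j my]]]; last by case: (no_move s i j y).
  have st : s d = t d by apply/eqP; apply: contraTT vs => /v0'->.
  have -> : s = (s * t^-1) * t by rewrite mulgVK.
  rewrite -(pm_mul rel) opM x0_pm //; last by rewrite permM st permK.
  by apply: perm_onM => //; apply: perm_onV.
case=> [[s [_ _ v0 _]]|[k [l my]]]; first by case: (no_move s i j x).
apply: (move_confluent _ _ mx my) => [v' wv' x' y'|l']; last exact: reached_supp rx.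
by apply: IH; apply: leq_trans wv' _.
Qed.

Definition absv (v : I -> int) : I -> nat := fun l => absz (v l).
Definition negv (v : I -> int) : I -> bool := fun l => (v l < 0)%R.
Definition posv v : I -> int := fun l => Posz (v l).

(** The extension to signed vectors.  The sign matrix is determined by v up to the
    coordinates where v vanishes, and those are harmless by [reached_sg]. *)
Definition reachedZ (v : I -> int) x :=
  exists2 y, reached (absv v) y & x = op (sg (negv v)) y.

Lemma reachedZ_uniq (v : I -> int) x y : reachedZ v x -> reachedZ v y -> x = y.
Proof. by move=> [x' rx ->] [y' ry ->]; rewrite (reached_uniq rx ry). Qed.

Lemma sg0 : sg (fun=> false) = 1.
Proof.
by apply: (@mulgI _ (sg (fun=> false))); rewrite (sg_mul rel) mulg1.
Qed.

Lemma pm1 : pm 1 = 1.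
Proof. by apply: (@mulgI _ (pm 1)); rewrite (pm_mul rel) !mulg1. Qed.

Lemma reachedZ_pos v x : reached v x -> reachedZ (posv v) x.
Proof.
move=> r; exists x => //; suff -> : negv (posv v) = fun=> false by rewrite sg0 op1.
by apply/funext.
Qed.

Lemma reachedZ_sg (e : I -> bool) (v : I -> int) x : (forall l, e l -> l \in D) ->
  reachedZ v x -> reachedZ (sgv e v) (op (sg e) x).
Proof.
move=> eD [y r ->]; have E : absv (sgv e v) = absv v.
  by apply/funext => l; rewrite /absv /sgv; case: ifP => // _; rewrite abszN.
exists y; rewrite ?E // -opM (sg_mul rel).
pose c l := negv (sgv e v) l (+) (e l (+) negv v l).
have cy : op (sg c) y = y.
  apply: reached_sg r => l; rewrite /c /negv /sgv /absv.
    case el: (e l); first by move=> _; exact: eD.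
    by case: (_ < _)%R.
  by case: (e l); lia.
rewrite -[in RHS]cy -[RHS]opM (sg_mul rel); congr (op (sg _) _).
by apply/funext => l; rewrite /c addbA addbb.
Qed.

Lemma reachedZ_pm s (v : I -> int) x : perm_on D s ->
  reachedZ v x -> reachedZ (pmv s v) (op (pm s) x).
Proof.
move=> sD [y r ->]; exists (op (pm s) y); first exact: (@reached_pm s (absv v)).
by rewrite -[LHS]opM (pm_sg rel) opM.
Qed.

(** Only the case v_i < v_j needs an argument: the last step of a run may then
    be taken to be (j,i), and [tr_swap] turns (tr i j)^-1 * tr j i into a signed
    transposition times tr i j. *)
Lemma reachedZ_trV i j v x : i \in D -> j \in D -> i != j -> reached v x ->
  reachedZ (fun l => if l == i then Posz (v l) - Posz (v j) else Posz (v l))%R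
    (op (tr i j)^-1 x).
Proof.
move=> iD jD ij r; have ji : j != i by rewrite eq_sym.
have vD l : 0 < v l -> l \in D by exact: reached_supp r.
have subD k m l : 0 < subv k m v l -> l \in D.
  by move=> sl; apply: vD; apply: leq_trans sl (subv_le _ _ _ _).
have [vj0|vj] := posnP (v j).
  rewrite -(reached_tr0 iD jD ij vj0 r) -opM mulVg op1.
  rewrite (_ : (fun _ => _) = posv v); first exact: reachedZ_pos.
  by apply/funext => l; rewrite vj0 subr0 if_same.
have [le|lt] := leqP (v j) (v i).
  have [|z rz] := @reached_ex (subv i j v) j (@subD i j).
    by rewrite /subv (negPf ji).
  have -> : x = op (tr i j) z.
    by apply: reached_uniq r _; rewrite -(subvK ij le); apply: reached_addv.
  rewrite -opM mulVg op1 (_ : (fun _ => _) = posv (subv i j v)).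
    exact: reachedZ_pos.
  apply/funext => l; rewrite /posv /subv; case: eqP => // ->; exact: subzn.
have [|z rz] := @reached_ex (subv j i v) j (@subD j i).
  by rewrite /subv eqxx; lia.
have -> : x = op (tr j i) z.
  by apply: reached_uniq r _; rewrite -(subvK ji (ltnW lt)); apply: reached_addv.
rewrite (tr_swap rel ij) -opM mulKg 2!opM.
have r' := reached_pm (perm_on_tperm iD jD) (reached_addv iD jD ij rz).
have eD l : pred1 i l -> l \in D by move=> /eqP->.
have := reachedZ_sg eD (reachedZ_pos r').
congr reachedZ; apply/funext => l; rewrite /sgv /posv /addv /subv /= tpermV.
have [->|li] := eqVneq l i; first by rewrite tpermL !eqxx (negPf ji); lia.
have [->|lj] := eqVneq l j; first by rewrite tpermR !eqxx (negPf ij); lia.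
by rewrite tpermD ?(negPf li) ?(negPf lj) // eq_sym.
Qed.

Lemma reachedZ_tr i j (v : I -> int) x : i \in D -> j \in D -> i != j ->
  reachedZ v x -> reachedZ (trv i j v) (op (tr i j) x).
Proof.
move=> iD jD ij [y r ->].
have nD l : negv v l -> l \in D.
  by move=> vl; apply: (reached_supp r); move: vl; rewrite /negv /absv; lia.
pose b := negv v i (+) negv v j.
have -> : op (tr i j) (op (sg (negv v)) y)
    = op (sg (negv v)) (op (if b then (tr i j)^-1 else tr i j) y).
  have sgK : sg (negv v) * sg (negv v) = 1.
    by rewrite (sg_mul rel) -sg0; congr sg; apply/funext => l; rewrite addbb.
  rewrite -!opM; congr op; apply: (@mulgI _ (sg (negv v))).
  rewrite [RHS]mulgA sgK mul1g mulgA (sg_tr rel) // -mulgA sgK mulg1.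
  by rewrite /b; case: (_ (+) _).
pose w l := (if l == i then if b then Posz (absv v l) - Posz (absv v j)
  else Posz (absv v l) + Posz (absv v j) else Posz (absv v l))%R.
have -> : trv i j v = sgv (negv v) w.
  apply/funext => l; rewrite /trv /sgv /w /b /absv /negv.
  case: eqP => [->|_]; last by case: ifP; lia.
  by case: (ltrP (v i) 0); case: (ltrP (v j) 0) => /=; lia.
apply: reachedZ_sg => //; rewrite /w; case: (b); first exact: (reachedZ_trV iD jD ij r).
have := reachedZ_pos (reached_addv iD jD ij r); congr reachedZ.
by apply/funext => l; rewrite /posv /addv; case: eqP => // ->.
Qed.

Variable rho : G -> (I -> int) -> (I -> int).
Hypothesis act : elementary_action tr sg pm rho.

Lemma reachedZ_products g (v : I -> int) x : products (elementary tr sg pm D) g ->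
  reachedZ v x -> reachedZ (rho g v) (op g x).
Proof.
move=> pg r; elim: pg => {g} [|a g ea _ IH]; first by rewrite (rho1 act) op1.
rewrite (rhoM act) opM; case: ea => [i j iD jD ij|e eD|s sD].
- by rewrite (rho_tr act) //; exact: reachedZ_tr.
- by rewrite (rho_sg act); exact: reachedZ_sg.
- by rewrite (rho_pm act); exact: reachedZ_pm.
Qed.

(** The coset is equivariant and x0 is attached to e_d, so an element fixing e_d
    fixes x0. *)
Lemma orbit_section g : products (elementary tr sg pm D) g ->
  rho g (deltav d) = deltav d -> op g x0 = x0.
Proof.
move=> pg gd; have r : reachedZ (deltav d) x0.
  rewrite (_ : deltav d = posv (fun l => l == d)); last first.
    by apply/funext => l; rewrite /deltav /posv; case: eqP.
  apply: reachedZ_pos; rewrite -[x0]op1 -pm1; apply: reached_axis.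
  - exact: perm_on1.
  - by rewrite perm1 eqxx.
  - by move=> l; rewrite perm1 => /negPf->.
have := reachedZ_products pg r; rewrite gd => r'; exact: reachedZ_uniq r' r.
Qed.

End EuclidSection.

(** * Removing one basis vector *)

Lemma mulg_swapV (G : groupType) (x y z : G) :
  x * y = z * x -> x * y^-1 = z^-1 * x.
Proof. by move=> E; apply: (@mulgI _ z); rewrite mulgA -E mulgK mulVKg. Qed.

Lemma productsM2 (G : groupType) (P : G -> Prop) g h :
  products P g -> products P h -> products P (g * h).
Proof.
move=> pg ph; elim: pg => [|a g' Pa _ IH]; first by rewrite mul1g.
by rewrite -mulgA; apply: productsM.
Qed.

Lemma products_gen (G : groupType) (P : G -> Prop) a : P a -> products P a.
Proof. by move=> Pa; rewrite -[a]mulg1; do 2?constructor. Qed.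

Section Presentation.
Variables (I : finType) (G : groupType).
Variables (tr : I -> I -> G) (sg : (I -> bool) -> G) (pm : {perm I} -> G).
Variable rho : G -> (I -> int) -> (I -> int).
Hypothesis rel : elementary_relations tr sg pm.
Hypothesis act : elementary_action tr sg pm rho.
Notation elem := (elementary tr sg pm).

Lemma elementaryV (D : {set I}) a : elem D a -> products (elem D) a^-1.
Proof.
case=> [i j iD jD ij|e eD|s sD].
- have sgK : sg (pred1 i) * sg (pred1 i) = 1.
    by rewrite (sg_mul rel) -(sg0 rel); congr sg; apply/funext => l; rewrite addbb.
  have -> : (tr i j)^-1 = sg (pred1 i) * (tr i j * sg (pred1 i)).
    rewrite mulgA (sg_tr rel) //= eqxx [j == i]eq_sym (negPf ij) /=.
    by rewrite -mulgA sgK mulg1.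
  have es : elem D (sg (pred1 i)) by constructor=> l /eqP->.
  apply: productsM => //; apply: productsM; first exact: elementary_tr.
  exact: products_gen.
- suff -> : (sg e)^-1 = sg e by apply: products_gen; constructor.
  apply: mulg1_eq; rewrite (sg_mul rel) -(sg0 rel); congr sg.
  by apply/funext => l; rewrite addbb.
- suff -> : (pm s)^-1 = pm s^-1.
    by apply: products_gen; constructor; exact: perm_onV.
  by apply: mulg1_eq; rewrite (pm_mul rel) mulVg (pm1 rel).
Qed.

Section Stabiliser.
Variables (D : {set I}) (d : I).
Hypothesis dD : d \in D.

Definition utr (a : I * bool) : G :=
  if a.2 then (tr d a.1)^-1 else tr d a.1.
Definition uword (s : seq (I * bool)) : G := foldr (fun a g => utr a * g) 1 s.
Definition usum (s : seq (I * bool)) (v : I -> int) : int :=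
  (\sum_(a <- s) (if a.2 then - v a.1 else v a.1))%R.
Definition uvalid (s : seq (I * bool)) := all (fun a => a.1 \in D :\ d) s.

Lemma uword_cat s t : uword (s ++ t) = uword s * uword t.
Proof. by elim: s => [|a s IH] /=; rewrite ?mul1g // IH mulgA. Qed.

Lemma uwordV s : uvalid s -> exists2 t, uvalid t & (uword s)^-1 = uword t.
Proof.
elim: s => [|[j b] s IH] /=; first by exists [::] => //=; rewrite invg1.
case/andP=> jD /IH[t tv E]; exists (t ++ [:: (j, ~~ b)]).
  by rewrite /uvalid all_cat [all _ t]tv /= jD.
by rewrite uword_cat invgM E /= mulg1 /utr /=; case: b; rewrite ?invgK.
Qed.

(** The subgroup of the products of the tr d l is normalised by the generators
    on the other indices. *)
Lemma push_letter a l : elem (D :\ d) a -> l \in D :\ d ->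
  exists2 t, uvalid t & a * tr d l = uword t * a.
Proof.
move=> ea lD; have := lD; rewrite !inE => /andP[ld lD'].
have dl : d != l by rewrite eq_sym.
case: ea => [i j iD jD ij|e eD|s sD].
- have := iD; rewrite !inE => /andP[id_ _]; have := jD; rewrite !inE => /andP[jd _].
  have [il|il] := eqVneq i l; last first.
    exists [:: (l, false)]; first by rewrite /uvalid /= lD.
    by rewrite /= mulg1 (tr_comm rel).
  subst l; exists [:: (i, false); (j, true)]; first by rewrite /uvalid /= iD jD.
  rewrite /= mulg1 /utr /=; apply: (@mulIg _ (tr d j)).
  rewrite -mulgA -(tr_chain rel) // 1?eq_sym //.
  rewrite -!mulgA; congr (_ * _); symmetry.
  by rewrite (tr_comm rel) // ?mulKg // eq_sym.
- have ed : e d = false by apply/negP => /eD; rewrite !inE eqxx.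
  exists [:: (l, e l)]; first by rewrite /uvalid /= lD.
  by rewrite (sg_tr rel) // ed /= mulg1.
- have sd : s d = d by apply: out_perm sD _; rewrite !inE eqxx.
  exists [:: (s l, false)]; first by rewrite /uvalid /= perm_closed ?lD.
  by rewrite (pm_tr rel) // sd /= mulg1.
Qed.

Lemma push_word a s : elem (D :\ d) a -> uvalid s ->
  exists2 t, uvalid t & a * uword s = uword t * a.
Proof.
move=> ea; elim: s => [|[l b] s IH] /=; first by exists [::]; rewrite // mul1g mulg1.
case/andP=> lD /IH[t tv E].
have [t' t'v E'] : exists2 t', uvalid t' & a * utr (l, b) = uword t' * a.
  have [t' t'v E'] := push_letter ea lD; rewrite /utr /=.
  case: b; last by exists t'.
  by have [u uv Eu] := uwordV t'v; exists u; rewrite // -Eu; exact: mulg_swapV.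
exists (t' ++ t); first by rewrite /uvalid all_cat [all _ t']t'v.
by rewrite uword_cat mulgA E' -!mulgA E.
Qed.

(** The subgroup H generated by the generators on D that fix e_d, in the form
    u h of a semidirect product. *)
Definition stab (g : G) : Prop := exists s h,
  [/\ uvalid s, products (elem (D :\ d)) h & g = uword s * h].

Lemma stab1 : stab 1.
Proof. by exists [::], 1; split; rewrite ?mulg1 //; constructor. Qed.

Lemma stab_utr a g : a.1 \in D :\ d -> stab g -> stab (utr a * g).
Proof.
move=> aD [s [h [sv ph ->]]]; exists (a :: s), h; split=> //=; last by rewrite mulgA.
by rewrite /uvalid /= aD.
Qed.

Lemma stab_products a g : products (elem (D :\ d)) a -> stab g -> stab (a * g).
Proof.
move=> pa sg_; elim: pa => [|b a' eb _ [s [h [sv ph E]]]]; first by rewrite mul1g.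
have [t tv Et] := push_word eb sv.
exists t, (b * h); split=> //; first exact: productsM.
by rewrite -mulgA E !mulgA Et.
Qed.

(** The action of G on its subsets: the orbit of [stab] is the set of cosets. *)
Definition translate (g : G) (C : G -> Prop) : G -> Prop :=
  fun h => C (g^-1 * h).

Lemma translate1 C : translate 1 C = C.
Proof. by apply/funext => h; rewrite /translate invg1 mul1g. Qed.

Lemma translateM g h C : translate (g * h) C = translate g (translate h C).
Proof. by apply/funext => k; rewrite /translate invgM mulgA. Qed.

Lemma translate_stab a : (forall g, stab g -> stab (a * g)) ->
  (forall g, stab g -> stab (a^-1 * g)) -> translate a stab = stab.
Proof.
move=> ha hV; apply/funext => g; apply/propext; rewrite /translate.
by split=> [/ha|/hV //]; rewrite mulVKg.
Qed.

Lemma translate_elem a : elem (D :\ d) a -> translate a stab = stab.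
Proof.
move=> ea; apply: translate_stab => g; apply: stab_products.
  exact: products_gen.
exact: elementaryV.
Qed.

Lemma fix_stab g : products (elem D) g -> rho g (deltav d) = deltav d -> stab g.
Proof.
move=> pg gd; have : translate g stab = stab.
  apply: (orbit_section rel translate1 translateM dD _ _ _ act pg gd).
  - move=> i j iD jD ij jd; have [->|id_] := eqVneq i d; last first.
      by apply: translate_elem; constructor; rewrite // !inE ?id_ ?jd.
    have jD' : j \in D :\ d by rewrite !inE jd.
    apply: translate_stab => k; first exact: (@stab_utr (j, false)).
    exact: (@stab_utr (j, true)).
  - move=> e eD ed; apply: translate_elem; constructor=> l el.
    by rewrite !inE eD // andbT; apply: contraNneq ed => <-.
  - move=> s sD sd; apply: translate_elem; constructor.
    apply/fintype.subsetP => l; rewrite inE => sl; rewrite !inE.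
    rewrite (fintype.subsetP sD) ?inE // andbT.
    by apply: contraNneq sl => ->; rewrite sd.
by move=> /(congr1 (fun C => C g)); rewrite /translate mulVg => <-; exact: stab1.
Qed.

Definition setv (c : int) (v : I -> int) : I -> int :=
  fun l => if l == d then c else v l.

Lemma setvK v : setv (v d) v = v.
Proof. by apply/funext => l; rewrite /setv; case: eqP => // ->. Qed.

(** The generators on the indices other than d ignore the coordinate d. *)
Lemma rho_setv h c v : products (elem (D :\ d)) h ->
  rho h (setv c v) = setv c (rho h v).
Proof.
move=> ph; elim: ph c v => {h} [|a h ea _ IH] c v; first by rewrite !(rho1 act).
rewrite !(rhoM act) IH; move: (rho h v) => {IH}{}v.
case: ea => [i j|e eD|s sD].
- rewrite !inE => /andP[/negPf id_ _] /andP[/negPf jd _] ij.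
  rewrite (rho_tr act) //; apply/funext => l; rewrite /trv /setv jd.
  have [->|//] := eqVneq l i; by rewrite id_.
- have ed : e d = false by apply/negP => /eD; rewrite !inE eqxx.
  rewrite (rho_sg act); apply/funext => l; rewrite /sgv /setv.
  by have [->|//] := eqVneq l d; rewrite ed.
- have sd : s d = d by apply: out_perm sD _; rewrite !inE eqxx.
  rewrite (rho_pm act); apply/funext => l; rewrite /pmv /setv.
  by rewrite -[in LHS](inj_eq (@perm_inj _ s)) permKV sd.
Qed.

Lemma rho_uword s v : uvalid s ->
  rho (uword s) v = fun l => if l == d then (v d + usum s v)%R else v l.
Proof.
elim: s => [|[j b] s IH] /=.
  move=> _; rewrite (rho1 act) /usum big_nil; apply/funext => l.
  by case: eqP => // ->; rewrite addr0.
rewrite !inE /= => /andP[/andP[jd _] /IH]; rewrite (rhoM act) => ->.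
have dj : d != j by rewrite eq_sym.
have trV w : rho (tr d j)^-1 w = fun l => if l == d then (w d - w j)%R else w l.
  have {1}-> : w = rho (tr d j) (fun l => if l == d then (w d - w j)%R else w l).
    rewrite (rho_tr act) //; apply/funext => l; rewrite /trv (negPf jd).
    by case: eqP => // ->; rewrite subrK.
  by rewrite -(rhoM act) mulVg (rho1 act).
rewrite /utr /usum big_cons /=; case: b => /=.
  rewrite trV; apply/funext => l; rewrite eqxx (negPf jd); case: eqP => // _.
  by rewrite addrAC [in RHS]addrA.
rewrite (rho_tr act) //; apply/funext => l; rewrite /trv (negPf jd).
by case: eqP => // _; rewrite addrAC [in RHS]addrA.
Qed.

Lemma utr_comm a b : a.1 != d -> b.1 != d -> commute (utr a) (utr b).
Proof.
move=> ad bd; have c : commute (tr d a.1) (tr d b.1).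
  by rewrite /commute (tr_comm rel) // eq_sym.
rewrite /utr; case: a.2; case: b.2 => //; do ?exact: commuteV.
- by apply/commute_sym/commuteV/commute_sym/commuteV.
- by apply/commute_sym/commuteV/commute_sym.
Qed.

(** The factors commute, so a letter can be moved next to an inverse letter;
    one exists because the exponent sum of each index vanishes. *)
Lemma uword_collapse s : uvalid s -> (forall v, usum s v = 0%R) -> uword s = 1.
Proof.
have [N] := ubnP (size s); elim: N s => // N IH [//|[j b] s] /= sN.
case/andP=> jD sv s0; have jd : j != d by move: jD; rewrite !inE => /andP[].
have : (j, ~~ b) \in s.
  apply/negPn/negP => nj; have := s0 (deltav j).
  rewrite /usum big_cons /= {1 2}/deltav eqxx /=.
  pose c : int := if b then (-1)%R else 1%R.
  suff : (0 <= c * \sum_(a <- s) (if a.2 then - deltav j a.1 else deltav j a.1))%R.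
    by rewrite /c; case: (b); move: (\sum_(a <- s) _)%R => S; lia.
  rewrite mulr_sumr big_seq; apply: sumr_ge0 => -[k b'] ks /=.
  rewrite /deltav; case: eqP => [kj|_]; last by rewrite oppr0 if_same mulr0.
  suff -> : b' = b by rewrite /c; case: (b).
  by apply/eqP; apply: contraNT nj => bb; rewrite -kj; case: (b) (b') bb ks => [] [].
move=> js; case/splitPr: js sv s0 sN => s1 s2.
rewrite /uvalid all_cat /= => /and3P[s1v _ s2v] s0 sN.
have comm1 : commute (utr (j, b)) (uword s1).
  elim: s1 s1v {s0 sN} => [|a s1 IH1] /=; first by move=> _; exact: commute1.
  rewrite !inE => /andP[/andP[ad _] /IH1]; apply: commuteM.
  exact: utr_comm.
rewrite uword_cat /= mulgA comm1 -mulgA [utr (j, b) * _]mulgA.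
have -> : utr (j, b) * utr (j, ~~ b) = 1.
  by rewrite /utr /=; case: (b); rewrite /= ?mulVg ?mulgV.
rewrite mul1g -uword_cat; apply: IH.
- by move: sN; rewrite !size_cat /=; lia.
- by rewrite /uvalid all_cat s1v.
move=> v; rewrite -(s0 v) /usum big_cons !big_cat big_cons /=.
by case: (b) => /=; lia.
Qed.

(** On vectors with v_d = 0 the factor u changes only the coordinate d and h the
    others, so h is trivial there, hence everywhere by [rho_setv]. *)
Lemma rho_stab_trivial s h : uvalid s -> products (elem (D :\ d)) h ->
  (forall v, rho (uword s * h) v = v) ->
  (forall v, rho h v = v) /\ uword s = 1.
Proof.
move=> sv ph gv.
have hv v : rho h v = v.
  have h0 : rho h (setv 0%R v) = setv 0%R v.
    rewrite rho_setv //; apply/funext => l.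
    have := congr1 (fun w : I -> int => w l) (gv (setv 0%R v)).
    by rewrite (rhoM act) rho_uword // rho_setv // /setv; case: eqP.
  rewrite -[in LHS](setvK v) (_ : setv (v d) v = setv (v d) (setv 0%R v)).
    rewrite rho_setv // h0; apply/funext => l; rewrite /setv.
    by case: eqP => // ->.
  by apply/funext => l; rewrite /setv; case: eqP.
split=> //; apply: uword_collapse => // v.
have := gv v; rewrite (rhoM act) hv rho_uword // => /(congr1 (fun w => w d)).
by rewrite eqxx; lia.
Qed.

End Stabiliser.

(** The generators and relations present a subgroup of GL_n(Z): no further
    relation is needed between products that act in the same way.  The induction
    is on the set D of indices that are involved. *)
Theorem elementary_faithful (D : {set I}) g : products (elem D) g ->
  (forall v, rho g v = v) -> g = 1.
Proof.
have [N] := ubnP #|D|; elim: N D g => // N IH D g DN pg gv.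
have [D0|[d dD]] := set_0Vmem D.
  elim: pg {gv} => // a h ea _ ->; rewrite mulg1.
  case: ea => [i j|e eD|s sD]; first by rewrite D0 inE.
    rewrite -(sg0 rel); congr sg; apply/funext => l; apply/negP => /eD.
    by rewrite D0 inE.
  rewrite -(pm1 rel); congr pm; apply/permP => l; rewrite perm1.
  by apply: out_perm sD _; rewrite D0 inE.
have [s [h [sv ph E]]] := fix_stab dD pg (gv _).
rewrite E in gv; have [hv s1] := rho_stab_trivial dD sv ph gv.
rewrite E s1 mul1g; apply: IH ph hv.
by move: DN; rewrite (cardsD1 d) dD.
Qed.

End Presentation.

(** * Common prefixes and cancellation in free groups *)

(** The length of x^-1 y is |x| + |y| - 2 lcp(x, y), and [lcp] is an ultrametric
    (the Cayley graph is a tree).  All the cancellation arguments below use only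
    these two facts. *)
Section CommonPrefix.
Variable T : eqType.
Implicit Types u v w : seq T.

Fixpoint lcp u v :=
  if u is a :: u' then
    if v is b :: v' then if a == b then (lcp u' v').+1 else 0 else 0
  else 0.

Lemma lcpC u v : lcp u v = lcp v u.
Proof.
elim: u v => [|a u IH] [|b v] //=; rewrite eq_sym.
by case: eqP => // _; rewrite IH.
Qed.

Lemma lcp_take u v : take (lcp u v) u = take (lcp u v) v.
Proof.
elim: u v => [|a u IH] [|b v] //=.
by case: eqP => //= -> ; rewrite IH.
Qed.

Lemma lcp_size u v : lcp u v <= size u.
Proof. by elim: u v => [|a u IH] [|b v] //=; case: eqP => // _; exact: IH. Qed.

Lemma lcp_max k u v : k <= size u -> k <= size v -> take k u = take k v ->
  k <= lcp u v.
Proof.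
elim: k u v => // k IH [|a u] [|b v] //= ku kv [-> E].
by rewrite eqxx; exact: IH.
Qed.

Lemma lcp_ultra u v w : minn (lcp u v) (lcp v w) <= lcp u w.
Proof.
elim: u v w => [|a u IH] [|b v] [|c w] //=; rewrite ?minn0 ?min0n //.
case: eqP => [->|_]; last by rewrite min0n.
by case: eqP => _; rewrite ?minn0 // minnSS ltnS.
Qed.

(** In an ultrametric triangle the two smallest values agree. *)
Lemma lcp_replace u v w : lcp u v < lcp v w -> lcp u w = lcp u v.
Proof.
move=> lt; have := lcp_ultra u v w; have := lcp_ultra u w v.
by rewrite (lcpC w v) => h1 h2; apply/eqP; rewrite eqn_leq; lia.
Qed.

End CommonPrefix.

Section ReducedProducts.
Variable X : choiceType.
Implicit Types (u v w : seq (letter X)) (x y z : free_group X).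

Lemma word_mul_cat u v : reduced (u ++ v) -> word_mul u v = u ++ v.
Proof.
elim: u => //= a u IH r; rewrite (IH (path_sorted r)).
by case: (u ++ v) r => //= b t /andP[/negPf->].
Qed.

Lemma word_mul_lcp u v : reduced u -> reduced v ->
  word_mul (word_inv u) v =
  word_inv (drop (lcp u v) u) ++ drop (lcp u v) v.
Proof.
elim: u v => [|a u IH] [|b v] ru rv //; rewrite ?cats0.
  by rewrite word_mul1 //; exact: word_inv_reduced.
rewrite [lcp _ _]/=; case: eqP => [<-|ab] /=.
  rewrite /word_inv /= rev_cons /word_mul foldr_rcons /= linvK eqxx.
  by apply: IH; [exact: path_sorted ru|exact: path_sorted rv].
apply: word_mul_cat; have := word_inv_reduced ru.
rewrite /word_inv /= rev_cons /reduced cat_rcons sorted_cat_cons => -> /=.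
by rewrite linvK eq_sym (introN eqP ab).
Qed.

Definition len x := size (word x).

Lemma word_inv_cat u v : word_inv (u ++ v) = word_inv v ++ word_inv u.
Proof. by rewrite /word_inv map_cat rev_cat. Qed.

Lemma size_word_inv u : size (word_inv u) = size u.
Proof. by rewrite /word_inv size_rev size_map. Qed.

Lemma lenV x : len x^-1 = len x.
Proof. exact: size_word_inv. Qed.

Lemma len_eq0 x : (len x == 0) = (x == 1).
Proof. by rewrite /len size_eq0 -(inj_eq val_inj). Qed.

Lemma word_lcp x y : word (x * y) =
  word_inv (drop (lcp (word x^-1) (word y)) (word x^-1)) ++
  drop (lcp (word x^-1) (word y)) (word y).
Proof.
rewrite -{1}[x]invgK; apply: word_mul_lcp; [exact: (valP x^-1)|exact: (valP y)].
Qed.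

Lemma len_lcp x y :
  len (x * y) + (lcp (word x^-1) (word y)).*2 = len x + len y.
Proof.
rewrite {1}/len word_lcp size_cat size_word_inv !size_drop -[len x]lenV /len.
have := lcp_size (word x^-1) (word y); have := lcp_size (word y) (word x^-1).
by rewrite (lcpC (word y)); move: (lcp _ _) (size _) (size _); lia.
Qed.

Lemma linv_neq (a : letter X) : a != linv a.
Proof. by case: a => i b; rewrite xpair_eqE /= negb_and; case: b; rewrite orbT. Qed.

(** Otherwise the letters of x would be antisymmetric about its middle, which then
    is either a letter equal to its inverse or a pair a a^-1. *)
Lemma lcp_inv x : x != 1 -> (lcp (word x) (word x^-1)).*2 < len x.
Proof.
rewrite -len_eq0 -lt0n => x0; rewrite ltnNge; apply/negP.
set k := lcp _ _; rewrite /len in x0 * => le.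
have a0 : letter X by case: (word x) x0.
pose m := size (word x); pose h := m.-1./2.
have hk : h < k by rewrite /h /m; lia.
have E : nth a0 (word x) h = linv (nth a0 (word x) (m - h.+1)).
  rewrite -(nth_take _ hk) lcp_take nth_take // /word_inv.
  rewrite [word x^-1]/= /word_inv nth_rev ?size_map; last by rewrite /h /m; lia.
  by rewrite (nth_map a0) // /h /m; lia.
have [mo|me] := boolP (odd m).
  have Eh : m - h.+1 = h by rewrite /h /m in mo *; lia.
  by move: E; rewrite Eh => /eqP; rewrite (negPf (linv_neq _)).
have Eh : m - h.+1 = h.+1 by rewrite /h /m in me *; lia.
have /(sortedP a0)/(_ h) := valP x; rewrite -/m => H.
have /H : h.+1 < m by rewrite /h /m in me *; lia.
by rewrite E Eh linvK eqxx.
Qed.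

End ReducedProducts.

(** * The tie-breaking weight *)

(** When x cancels exactly half of itself on both sides, slides along x keep the
    lengths.  They replace a prefix of a neighbour by another one of the same
    length, and one of the two directions lowers that prefix in the
    lexicographic order, which is encoded by numerals in a base exceeding all
    the digits.  Only the initial halves of a word and of its inverse are
    weighed, since the end of the word is common to both. *)
Section HalfWeight.
Variable I : finType.
Implicit Types (p q r u : seq (letter I)) (x y : free_group I).

Definition digit (a : letter I) : nat := enum_rank (a : I * bool).
Definition base := #|{: I * bool}|.

Fixpoint numeral u :=
  if u is a :: v then digit a * base ^ size v + numeral v else 0.

Lemma digit_lt a : digit a < base.
Proof. exact: ltn_ord. Qed.

Lemma numeral_cat u v : numeral (u ++ v) = numeral u * base ^ size v + numeral v.
Proof.
by elim: u => //= a u ->; rewrite size_cat expnD mulnDl mulnA addnA.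
Qed.

Lemma numeral_lt u : numeral u < base ^ size u.
Proof.
elim: u => //= a u IH; rewrite expnS.
apply: (@leq_trans ((digit a).+1 * base ^ size u)); last first.
  by rewrite leq_mul2r digit_lt orbT.
by rewrite mulSn addnC ltn_add2r.
Qed.

Lemma numeral_inj u v : size u = size v -> numeral u = numeral v -> u = v.
Proof.
elim: u v => [|a u IH] [|b v] //= [suv]; rewrite suv => E.
have lu := numeral_lt u; have lv := numeral_lt v; rewrite suv in lu.
have pos : 0 < base ^ size v by apply: leq_ltn_trans lv.
have ab : digit a = digit b.
  by have := congr1 (divn^~ (base ^ size v)%N) E; rewrite !divnMDl // !divn_small // !addn0.
move: E; rewrite ab => /addnI/(IH _ suv)->; congr cons.
by apply: enum_rank_inj; apply: val_inj.
Qed.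

Definition half u := take (uphalf (size u)) u.
Definition half_weight u := numeral (half u) + numeral (half (word_inv u)).

Lemma half_weightV x : half_weight (word x^-1) = half_weight (word x).
Proof. by rewrite /half_weight word_invK addnC. Qed.

(** The prefixes p and q lie in the first half of the words, hence their inverses
    lie outside the first half of the inverse words. *)
Lemma half_weight_lt p q r : size p = size q -> size q <= size r ->
  numeral p < numeral q -> half_weight (p ++ r) < half_weight (q ++ r).
Proof.
move=> pq qr lt; rewrite /half_weight /half !word_inv_cat !size_cat !size_word_inv pq.
set h := uphalf _; rewrite addnC -/h.
have hh : uphalf (size r + size q) = h by rewrite addnC.
rewrite !take_cat !size_word_inv pq.
have qh : h < size q = false by rewrite /h; lia.
rewrite qh hh.
have -> : (if h < size r then take h (word_inv r)
           else word_inv r ++ take (h - size r) (word_inv p))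
        = (if h < size r then take h (word_inv r)
           else word_inv r ++ take (h - size r) (word_inv q)).
  case: ltnP => // rh; have -> : h - size r = 0 by rewrite /h; lia.
  by rewrite !take0.
rewrite addnC ltn_add2r !numeral_cat ltn_add2r ltn_pmul2r //.
have b0 : 0 < base.
  by case: q lt {pq qr h hh qh} => // a q _; exact: leq_ltn_trans (digit_lt a).
by rewrite expn_gt0 b0.
Qed.

Lemma half_weight_mul x y k : lcp (word x^-1) (word y) = k ->
  len x = k.*2 -> k.*2 <= len y ->
  numeral (take k (word x)) < numeral (take k (word x^-1)) ->
  len (x * y) = len y /\ half_weight (word (x * y)) < half_weight (word y).
Proof.
move=> kE xk yk lt; split; first by have := len_lcp x y; rewrite kE; lia.
have E : word_inv (drop k (word x^-1)) = take k (word x).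
  rewrite /word_inv [word x^-1]/= /word_inv drop_rev map_rev revK size_map.
  rewrite map_take mapK; last exact: linvK.
  by congr take; move: xk; rewrite /len; lia.
have tE : take k (word y) = take k (word x^-1) by rewrite -kE lcp_take.
rewrite word_lcp kE E -[in ltnRHS](cat_take_drop k (word y)) tE.
move: lt xk yk; rewrite /len => lt xk yk.
have ks : size (take k (word x)) = k by rewrite size_takel // xk; lia.
have ks' : size (take k (word x^-1)) = k by rewrite size_takel // -kE lcp_size.
by apply: half_weight_lt => //; rewrite ks' // size_drop; lia.
Qed.

End HalfWeight.

(** * Nielsen's theorem *)

Lemma aut_fgen_eq (X : choiceType) (f g : aut (free_group X)) :
  (forall i, f (fgen i) = g (fgen i)) -> f = g.
Proof.
by move=> fg; apply: aut_ext; apply: fg_morph_eq => //; exact: autM.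
Qed.

Lemma fg_liftV (X : choiceType) (G : groupType) (f : X -> G) x :
  fg_lift f x^-1 = (fg_lift f x)^-1.
Proof. by symmetry; apply: mulg1_eq; rewrite -fg_liftM mulgV. Qed.

Lemma fg_lift_can (X : choiceType) (f g : X -> free_group X) :
  (forall i, fg_lift g (f i) = fgen i) -> cancel (fg_lift f) (fg_lift g).
Proof.
move=> fg; apply: fg_morph_eq => // [x y|i]; first by rewrite !fg_liftM.
by rewrite fg_lift_gen.
Qed.

Definition fg_aut (X : choiceType) (f g : X -> free_group X)
    (fg : forall i, fg_lift g (f i) = fgen i)
    (gf : forall i, fg_lift f (g i) = fgen i) : aut (free_group X) :=
  Aut (@fg_liftM _ _ f) (fg_lift_can fg) (fg_lift_can gf).

Section ElementaryAutomorphisms.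
Variable I : finType.
Notation F := (free_group I).
Implicit Types (i j k l : I) (e : I -> bool) (s t : {perm I}).

(** The case i = j gives the identity, so that [tr_aut] is defined for all
    pairs of indices. *)
Definition tr_gen i j l : F :=
  if (l == j) && (i != j) then fgen l * fgen i else fgen l.
Definition tr_gen_inv i j l : F :=
  if (l == j) && (i != j) then fgen l * (fgen i)^-1 else fgen l.
Definition sg_gen e l : F := if e l then (fgen l)^-1 else fgen l.
Definition pm_gen s l : F := fgen (s l).

Fact tr_genK i j l : fg_lift (tr_gen_inv i j) (tr_gen i j l) = fgen l.
Proof.
rewrite /tr_gen; case: andP => [[/eqP-> ij]|/andP/negPf n].
  by rewrite fg_liftM !fg_lift_gen /tr_gen_inv eqxx ij (negPf ij) /= mulgVK.
by rewrite fg_lift_gen /tr_gen_inv n.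
Qed.

Fact tr_genVK i j l : fg_lift (tr_gen i j) (tr_gen_inv i j l) = fgen l.
Proof.
rewrite /tr_gen_inv; case: andP => [[/eqP-> ij]|/andP/negPf n].
  by rewrite fg_liftM fg_liftV !fg_lift_gen /tr_gen eqxx ij (negPf ij) /= mulgK.
by rewrite fg_lift_gen /tr_gen n.
Qed.

Fact sg_genK e l : fg_lift (sg_gen e) (sg_gen e l) = fgen l.
Proof.
rewrite {2}/sg_gen; case el: (e l); rewrite ?fg_liftV fg_lift_gen /sg_gen el //.
by rewrite invgK.
Qed.

Fact pm_genK s l : fg_lift (pm_gen s^-1) (pm_gen s l) = fgen l.
Proof. by rewrite fg_lift_gen /pm_gen permK. Qed.

Fact pm_genVK s l : fg_lift (pm_gen s) (pm_gen s^-1 l) = fgen l.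
Proof. by rewrite fg_lift_gen /pm_gen permKV. Qed.

Definition tr_aut i j : aut F := fg_aut (@tr_genK i j) (@tr_genVK i j).
Definition sg_aut e : aut F := fg_aut (@sg_genK e) (@sg_genK e).
Definition pm_aut s : aut F := fg_aut (@pm_genK s) (@pm_genVK s).

Lemma tr_autE i j : i != j -> tr_aut i j (fgen j) = fgen j * fgen i.
Proof. by move=> ij; rewrite [LHS]fg_lift_gen /tr_gen eqxx ij. Qed.

Lemma tr_aut_id i j l : l != j -> tr_aut i j (fgen l) = fgen l.
Proof. by move=> /negPf lj; rewrite [LHS]fg_lift_gen /tr_gen lj. Qed.

Lemma sg_autE e l : sg_aut e (fgen l) = if e l then (fgen l)^-1 else fgen l.
Proof. exact: fg_lift_gen. Qed.

Lemma sg1_autE i l :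
  sg_aut (pred1 i) (fgen l) = if l == i then (fgen l)^-1 else fgen l.
Proof. exact: sg_autE. Qed.

Lemma pm_autE s l : pm_aut s (fgen l) = fgen (s l).
Proof. exact: fg_lift_gen. Qed.

Notation Nielsen := (products (elementary tr_aut sg_aut pm_aut [set: I])).

Lemma sg_autK e : sg_aut e * sg_aut e = 1.
Proof.
apply: aut_fgen_eq => l; rewrite aut_mulE sg_autE.
by case el: (e l); rewrite ?autV sg_autE el ?invgK.
Qed.

Lemma Nielsen_tr i j : i != j -> Nielsen (tr_aut i j).
Proof. by move=> ij; apply: products_gen; constructor; rewrite ?inE. Qed.

Lemma Nielsen_sg e : Nielsen (sg_aut e).
Proof. by apply: products_gen; constructor=> l; rewrite inE. Qed.

Lemma Nielsen_pm s : Nielsen (pm_aut s).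
Proof. by apply: products_gen; constructor; apply/fintype.subsetP => l; rewrite !inE. Qed.

Lemma NielsenV f : Nielsen f -> Nielsen f^-1.
Proof.
elim=> [|a g ea _ IH]; first by rewrite invg1; constructor.
rewrite invgM; apply: productsM2 => //; case: ea => [i j _ _ ij|e _|s _].
- suff -> : (tr_aut i j)^-1 = sg_aut (pred1 i) * (tr_aut i j * sg_aut (pred1 i)).
    apply: productsM2; first exact: Nielsen_sg.
    by apply: productsM2; [exact: Nielsen_tr|exact: Nielsen_sg].
  apply: mulg1_eq; apply: aut_fgen_eq => l; rewrite !aut_mulE.
  have ji : j != i by rewrite eq_sym.
  have [->|lj] := eqVneq l j.
    rewrite sg1_autE (negPf ji) tr_autE // autM !sg1_autE eqxx (negPf ji).
    by rewrite autM autV tr_autE // tr_aut_id // mulgK.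
  rewrite sg1_autE; have [->|li] := eqVneq l i.
    by rewrite autV tr_aut_id // autV sg1_autE eqxx invgK tr_aut_id.
  by rewrite tr_aut_id // sg1_autE (negPf li) tr_aut_id.
- suff -> : (sg_aut e)^-1 = sg_aut e by exact: Nielsen_sg.
  exact/mulg1_eq/sg_autK.
- suff -> : (pm_aut s)^-1 = pm_aut s^-1 by exact: Nielsen_pm.
  by apply: mulg1_eq; apply: aut_fgen_eq => l; rewrite aut_mulE !pm_autE permKV.
Qed.

Definition letter_im (f : aut F) (a : letter I) : F :=
  letter_val (fun l => f (fgen l)) a.

Lemma letter_imV f a : letter_im f (linv a) = (letter_im f a)^-1.
Proof. exact: letter_valV. Qed.

Lemma letter_im_neq1 f a : letter_im f a != 1.
Proof.
apply/eqP; case: a => i b; rewrite /letter_im /letter_val /= => E.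
have : f (fgen i) = f 1 by rewrite aut1; case: b E => // /(congr1 invg); rewrite invgK invg1.
by move=> /(can_inj (autK f)) /(congr1 (@word _)).
Qed.

Definition word_im f w := foldr (fun a g => letter_im f a * g) 1 w.

Lemma word_im_cons f a w : word_im f (a :: w) = letter_im f a * word_im f w.
Proof. by []. Qed.

(** Conjugating a transvection by the signs of a and c gives the automorphism that
    replaces the letter a by a c; composed with f it replaces f(a) by
    f(a) f(c). *)
Definition slide_sign (a c : letter I) l :=
  (l == a.1) && a.2 || (l == c.1) && c.2.

Definition slide (a c : letter I) : aut F :=
  sg_aut (slide_sign a c) * (tr_aut c.1 a.1 * sg_aut (slide_sign a c)).

Lemma Nielsen_slide a c : a.1 != c.1 -> Nielsen (slide a c).
Proof.
move=> ac; apply: productsM2; first exact: Nielsen_sg.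
apply: productsM2; last exact: Nielsen_sg.
by apply: Nielsen_tr; rewrite eq_sym.
Qed.

Lemma slideE f a c : a.1 != c.1 ->
  letter_im (f * slide a c) a = letter_im f a * letter_im f c.
Proof.
move=> ac; have ca : c.1 != a.1 by rewrite eq_sym.
have ea : slide_sign a c a.1 = a.2 by rewrite /slide_sign eqxx (negPf ac) orbF.
have ec : slide_sign a c c.1 = c.2 by rewrite /slide_sign eqxx (negPf ca).
rewrite /letter_im /letter_val /slide !aut_mulE sg_autE ea.
case: (a.2) ea => ea; rewrite ?autV tr_autE // autM !sg_autE ea ec;
  by case: (c.2); rewrite ?(autM, autV) ?invgM ?invgK.
Qed.

Lemma slide_id f a c l : l != a.1 -> (f * slide a c) (fgen l) = f (fgen l).
Proof.
move=> la; rewrite /slide !aut_mulE sg_autE.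
case E: (slide_sign a c l); last by rewrite tr_aut_id // sg_autE E.
by rewrite autV tr_aut_id // autV sg_autE E invgK.
Qed.

Definition total (m : F -> nat) (f : aut F) := \sum_l m (f (fgen l)).

Lemma total_slide (m : F -> nat) f a c : (forall x, m x^-1 = m x) -> a.1 != c.1 ->
  total m (f * slide a c) + m (letter_im f a) =
  total m f + m (letter_im f a * letter_im f c).
Proof.
move=> mV ac; have ml g b : m (letter_im g b) = m (g (fgen b.1)).
  by rewrite /letter_im /letter_val; case: b.2; rewrite ?mV.
rewrite -(slideE f ac) !ml /total (bigD1 a.1) // [in RHS](bigD1 a.1) //.
rewrite (eq_bigr (fun l => m (f (fgen l)))) => [|l /andP[_ la]].
  by rewrite addnAC [RHS]addnAC; congr (_ + _); exact: addnC.
by rewrite slide_id.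
Qed.

(** An automorphism is irreducible when no slide lowers the total length, nor the
    total half weight at constant total length. *)
Section Irreducible.
Variable f : aut F.
Notation U := (letter_im f).
Notation wt x := (half_weight (word x)).
Hypothesis irr : forall a c : letter I, a.1 != c.1 ->
  len (U a) <= len (U a * U c) /\
  (len (U a * U c) = len (U a) -> wt (U a) <= wt (U a * U c)).

Definition cancel_len (a c : letter I) := lcp (word (U a)^-1) (word (U c)).
Notation L := cancel_len.

(** Two letters on the same generator that do not cancel are equal. *)
Lemma letter_same_gen (a c : letter I) : c != linv a -> a.1 = c.1 -> c = a.
Proof.
case: a c => [i b] [j b'] /= n ij; subst j; congr pair.
by case: b b' n => [] [] //; rewrite /linv /= eqxx.
Qed.

Lemma cancel_le (a c : letter I) : c != linv a ->
  (L a c).*2 <= len (U a) /\ (L a c).*2 <= len (U c).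
Proof.
move=> ca; have [ac|ac] := eqVneq a.1 c.1.
  rewrite (letter_same_gen ca ac) /L.
  have := lcp_inv (letter_im_neq1 f (linv a)).
  by rewrite letter_imV invgK lenV => /ltnW.
have [le1 _] := irr ac.
have [|le2 _] := @irr (linv c) (linv a); first by rewrite eq_sym.
have := len_lcp (U a) (U c); rewrite -/(L a c).
move: le2 le1; rewrite !letter_imV -invgM !lenV.
by move: (len (U a)) (len (U c)) (len (_ * _)) (L a c); lia.
Qed.

(** At most half of U b is cancelled on each side by [cancel_le].  If both halves
    are cancelled completely, the two halves read from the ends of U b are
    distinct prefixes p of U b and q of its inverse; if p < q then sliding b
    onto c lowers the half weight, and if q < p then sliding b onto a does. *)
Lemma cancel_lt (a b c : letter I) : b != linv a -> c != linv b ->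
  L a b + L b c < len (U b).
Proof.
move=> ba cb; have [_ le1] := cancel_le ba; have [le2 _] := cancel_le cb.
rewrite ltnNge; apply/negP => le.
have L1 : len (U b) = (L a b).*2 by lia.
have L2 : len (U b) = (L b c).*2 by lia.
have tie := lcp_inv (letter_im_neq1 f b).
have ab : a.1 != b.1.
  apply/eqP => /(letter_same_gen ba) E; move: tie; rewrite L1 -E /L lcpC E.
  by rewrite ltnn.
have bc : b.1 != c.1.
  apply/eqP => /(letter_same_gen cb) E; move: tie; rewrite L2 E /L lcpC.
  by rewrite ltnn.
set k := L b c in L2.
have kab : L a b = k by lia.
have [] := ltngtP (numeral (take k (word (U b)))) (numeral (take k (word (U b)^-1))).
- move=> lt; have [_ le3] := cancel_le cb.
  have [E lt'] := half_weight_mul (erefl k) L2 le3 lt.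
  have [|_] := @irr (linv c) (linv b); first by rewrite eq_sym.
  rewrite !letter_imV -invgM !lenV => /(_ E).
  by rewrite !half_weightV leqNgt lt'.
- move=> gt; have [le3 _] := cancel_le ba.
  have kE : lcp (word (U b)^-1^-1) (word (U a)^-1) = k.
    by rewrite invgK lcpC -kab.
  have := half_weight_mul kE; rewrite !lenV invgK -kab => /(_ L1 le3).
  rewrite kab -invgM !lenV !half_weightV => /(_ gt)[E lt'].
  by have [_ /(_ E)] := irr ab; rewrite leqNgt lt'.
move=> /numeral_inj E; have : k <= lcp (word (U b)) (word (U b)^-1).
  have sb : k <= size (word (U b)) by move: L2; rewrite /len; lia.
  apply: lcp_max => //; first by move: sb; rewrite -/(len _) -lenV.
  by apply: E; rewrite !size_takel // -/(len _) lenV.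
by lia.
Qed.

(** The first letter of a reduced word is never absorbed: part of U a survives, so
    the cancellation between U c and the whole image is that between U c and
    U a.  The summand L c a in the bound is what the next letter on the left may
    still cancel. *)
Lemma len_word_im (a : letter I) w (c : letter I) :
  path (fun a b => b != linv a) a w -> a != linv c ->
  lcp (word (U c)^-1) (word (word_im f (a :: w))) = L c a /\
  L c a + (size w).+1 <= len (word_im f (a :: w)).
Proof.
elim: w a c => [|b w IH] a c pw ac; rewrite word_im_cons.
  rewrite mulg1; split=> //; have [_ le] := cancel_le ac.
  have : len (U a) != 0 by rewrite len_eq0 letter_im_neq1.
  by move: (len (U a)) (L c a) le; rewrite [size _]/=; lia.
case/andP: pw => ba pw; have [E le] := IH b a pw ba.
move: (word_im f (b :: w)) => V in E le *; have lt := cancel_lt ac ba.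
have lV := len_lcp (U a) V; rewrite E -/(L a b) in lV.
have lV' := len_lcp (U a)^-1 (U a * V); rewrite mulKg invgK lenV in lV'.
have key : L c a < lcp (word (U a)) (word (U a * V)).
  move: lV lV' lt; move: (len (U a)) (len (U a * V)) (len V) (L c a) (L a b).
  by move: (lcp _ _); lia.
split; first exact: lcp_replace key.
move: lV le lt; rewrite [size (b :: w)]/=.
move: (len (U a)) (len (U a * V)) (len V) (L c a) (L a b) (size w).
by lia.
Qed.

Lemma len_im x : size (word x) <= len (f x).
Proof.
have -> : f x = word_im f (word x).
  apply: (fg_morph_eq (@autM _ f) (@fg_liftM _ _ (fun l => f (fgen l)))) => i.
  by rewrite fg_lift_gen.
case: x => [[//|a w]] rw; rewrite [word _]/=.
by have [_] := len_word_im rw (linv_neq a); apply: leq_trans; exact: leq_addl.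
Qed.

(** By [len_im] the element f^-1 (x_i) has length one for each i. *)
Lemma irreducible_Nielsen : Nielsen f.
Proof.
have gen_im i : {a : letter I | word (f^-1 (fgen i)) = [:: a]}.
  have := len_im (f^-1 (fgen i)).
  rewrite -aut_mulE mulgV [len _]/(size [:: (i, false)]).
  have : word (f^-1 (fgen i)) != [::].
    apply/eqP => E; have E1 : f^-1 (fgen i) = 1 by apply: val_inj.
    have /(congr1 (@word _)) // : fgen i = 1.
    by rewrite -(aut1 f) -E1 -aut_mulE mulgV.
  by case: (word _) => // a [] // _ _; exists a.
pose s i := (sval (gen_im i)).1; pose e i := (sval (gen_im i)).2.
have fE i : f^-1 (fgen i) = if e i then (fgen (s i))^-1 else fgen (s i).
  apply: val_inj => /=; rewrite /e /s; case: (gen_im i) => -[j b] /= ->.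
  by case: b.
have s_inj : injective s.
  move=> i j sij; have : fgen i = fgen j \/ fgen i = (fgen j)^-1.
    have := fE i; have := fE j; rewrite sij.
    have inj := can_inj (autK f^-1).
    by case: (e i); case: (e j) => Ej Ei; [left|right|right|left]; apply: inj;
       rewrite ?autV Ei Ej ?invgK.
  by case=> /(congr1 (@word _)) [].
suff -> : f = (pm_aut (perm s_inj) * sg_aut e)^-1.
  by apply: NielsenV; apply: productsM2; [exact: Nielsen_pm|exact: Nielsen_sg].
apply: invg_inj; rewrite invgK; apply: aut_fgen_eq => i.
rewrite fE aut_mulE sg_autE; case: (e i); by rewrite ?autV pm_autE permE.
Qed.

End Irreducible.

(** Induction on the total length and then on the total half weight of the
    images of the generators. *)
Theorem Nielsen_generation f : Nielsen f.
Proof.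
have [M] := ubnP (total (@len _) f); elim: M f => // M IHM f fM.
have [N] := ubnP (total (fun x => half_weight (word x)) f).
elim: N f fM => // N IHN f fM fN.
case: (pselect (exists a c : letter I, a.1 != c.1 /\
    Nielsen (f * slide a c))) => [[a [c [ac]]]|irr].
  rewrite -[X in _ -> Nielsen X](mulgK (slide a c) f) => h.
  by apply: productsM2 => //; exact/NielsenV/Nielsen_slide.
apply: irreducible_Nielsen => a c ac.
have tl := total_slide f (@lenV _) ac.
have tw := total_slide f (@half_weightV _) ac.
split=> [|E]; rewrite leqNgt; apply/negP => lt; apply: irr; exists a, c;
  split=> //.
  apply: IHM; rewrite -ltnS; apply: leq_trans fM.
  by rewrite ltnS -(ltn_add2r (len (letter_im f a))) tl ltn_add2l.
apply: IHN.
  suff -> : total (@len _) (f * slide a c) = total (@len _) f by [].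
  by apply/eqP; rewrite -(eqn_add2r (len (letter_im f a))) tl E.
rewrite -ltnS; apply: leq_trans fN.
by rewrite ltnS -(ltn_add2r (half_weight (word (letter_im f a)))) tw ltn_add2l.
Qed.

End ElementaryAutomorphisms.

(** * The action on H_1 by exponent sums *)

(** The additive group of integers in multiplicative notation, as a target for
    homomorphisms from free groups. *)
Definition mulz_group := int.
HB.instance Definition _ := Choice.on mulz_group.
HB.instance Definition _ := isGroup.Build mulz_group
  (@addrA int) (@add0r int) (@addr0 int) (@addNr int) (@subrr int).

Lemma H1_projM (G : groupType) (x y : G) :
  (proj (derived G) (x * y) : H1 G) =
  (proj (derived G) x : H1 G) * (proj (derived G) y : H1 G).
Proof. exact: projM. Qed.

Lemma IO_normal n : is_normal_subgroup (IO n).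
Proof.
split; first split=> [a|f g hf hg a|f hf a].
- exact: out_act1.
- by rewrite out_actA hg hf.
- by rewrite -[in LHS](hf a) -out_actA mulVg out_act1.
by move=> g f hf a; rewrite !out_actA hf -out_actA mulgV out_act1.
Qed.

Section ExponentSums.
Variable n : nat.
Notation F := (free_group 'I_n).
Implicit Types (i j k l : 'I_n) (f g : aut F) (v : 'I_n -> int).

(** Triviality on H_1 can be tested on generators. *)
Lemma out_class_IO f :
  (forall l, nset (derived F) ((f (fgen l))^-1 * fgen l)) -> IO n (out_class f).
Proof.
move=> fl a; rewrite -[a]repr_proj out_actE.
have M1 : {morph (fun x : F => proj (derived F) (f x) : H1 F) : x y / x * y}.
  by move=> x y; rewrite autM; exact: H1_projM.
have M2 : {morph (fun x : F => proj (derived F) x : H1 F) : x y / x * y}.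
  by move=> x y; exact: H1_projM.
apply: (fg_morph_eq M1 M2) => l.
by apply/projP.
Qed.

Lemma MijE i j (ij : i != j) :
  Mij ij (fgen i) = fgen j * fgen i * (fgen j)^-1.
Proof. exact: subst_gen_i. Qed.

Lemma Mij_id i j (ij : i != j) l : l != i -> Mij ij (fgen l) = fgen l.
Proof. exact: subst_gen_l. Qed.

Lemma MijkE i j k (ij : i != j) (ik : i != k) :
  Mijk ij ik (fgen i) = fgen i * commutator (fgen j) (fgen k).
Proof. exact: subst_gen_i. Qed.

Lemma Mijk_id i j k (ij : i != j) (ik : i != k) l :
  l != i -> Mijk ij ik (fgen l) = fgen l.
Proof. exact: subst_gen_l. Qed.

Lemma magnus_IO : (magnus_generators n `<=` IO n)%classic.
Proof.
have [d1 _ dV] := generated_subgroup (@commutators F).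
have dC a b : nset (derived F) (commutator a b).
  by apply: sub_gen_smallest; exists a => //; exists b.
have dVg (x : F) : nset (derived F) (x^-1 * x).
  by rewrite mulVg.
move=> _ [[i [j [ij ->]]]|[i [j [k [ij [ik [_ ->]]]]]]]; apply: out_class_IO => l.
  have [->|li] := eqVneq l i; last by rewrite Mij_id //; exact: dVg.
  rewrite MijE.
  have -> : (fgen j * fgen i * (fgen j)^-1)^-1 * fgen i
    = commutator (fgen j) (fgen i)^-1.
    by rewrite /commutator !invgM !invgK !mulgA.
  exact: dC.
have [->|li] := eqVneq l i; last by rewrite Mijk_id //; exact: dVg.
by rewrite MijkE invgM mulgVK; apply: dV; exact: dC.
Qed.

Definition esum i (x : F) : int :=
  fg_lift (fun l => Posz (l == i) : mulz_group) x.

Lemma esumM i x y : esum i (x * y) = (esum i x + esum i y)%R.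
Proof. exact: (@fg_liftM _ mulz_group). Qed.

Lemma esumV i x : esum i x^-1 = (- esum i x)%R.
Proof. exact: (@fg_liftV _ mulz_group). Qed.

Lemma esum_gen i l : esum i (fgen l) = Posz (l == i).
Proof. exact: (@fg_lift_gen _ mulz_group). Qed.

Lemma esum_derived i x : nset (derived F) x -> esum i x = 0%R.
Proof.
suff : (nset (derived F) `<=` [set y | esum i y = 0%R])%classic by exact.
apply: smallest_sub => [|_ [a _ [b _ <-]] /=]; last first.
  by rewrite /commutator !esumM !esumV; lia.
split=> [|x' y' /= hx hy|x' /= hx] //=.
- by rewrite esumM hx hy.
- by rewrite esumV hx.
Qed.

(** The matrix of f on Z^n = H_1, whose columns are the exponent sums of the
    images of the generators. *)
Definition esum_act f v : 'I_n -> int :=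
  fun i => (\sum_l esum i (f (fgen l)) * v l)%R.

Lemma esum_aut i f x : esum i (f x) = esum_act f (esum^~ x) i.
Proof.
pose h (x : F) : mulz_group := esum_act f (esum^~ x) i.
have hM : {morph h : x y / x * y}.
  move=> y z; rewrite /h /esum_act; under eq_bigr do rewrite esumM mulrDr.
  exact: big_split.
have eM : {morph (fun x => esum i (f x) : mulz_group) : x y / x * y}.
  by move=> y z; rewrite autM; exact: esumM.
apply: (fg_morph_eq eM hM) => l; rewrite /h /esum_act (bigD1 l) //= big1.
  by rewrite esum_gen eqxx mulr1 addr0.
by move=> k kl; rewrite esum_gen eq_sym (negPf kl) mulr0.
Qed.

Lemma esum_actM f g v : esum_act (f * g) v = esum_act f (esum_act g v).
Proof.
apply/funext => i; rewrite /esum_act.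
under eq_bigr do rewrite aut_mulE esum_aut /esum_act mulr_suml.
rewrite exchange_big; apply: eq_bigr => k _; rewrite mulr_sumr.
by apply: eq_bigr => l _; rewrite mulrA.
Qed.

Lemma sum_delta v i : (\sum_l Posz (l == i) * v l)%R = v i.
Proof.
rewrite (bigD1 i) //= eqxx mul1r big1 ?addr0 // => l /negPf->.
by rewrite mul0r.
Qed.

Lemma esum_act_IO f v : IO n (out_class f) -> esum_act f v = v.
Proof.
move=> fIO; apply/funext => i; rewrite -[RHS]sum_delta.
apply: eq_bigr => l _; congr (_ * _)%R.
have := fIO (proj (derived F) (fgen l)); rewrite out_actE => /projP/(esum_derived i).
rewrite esumM esumV esum_gen addrC => /eqP.
by rewrite subr_eq0 => /eqP.
Qed.

Lemma esum_act_tr i j : i != j -> esum_act (tr_aut i j) = trv i j.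
Proof.
move=> ij; apply/funext => v; apply/funext => a; rewrite /esum_act /trv.
transitivity (\sum_l (Posz (l == a) * v l +
   (if a == i then Posz (l == j) * v l else 0)))%R.
  apply: eq_bigr => l _; have [->|lj] := eqVneq l j.
    rewrite tr_autE // esumM !esum_gen mulrDl; congr (_ + _)%R.
    by rewrite eq_sym; case: eqP => _; rewrite ?mul1r ?mul0r.
  by rewrite tr_aut_id // esum_gen mul0r if_same addr0.
rewrite big_split /= sum_delta; case: eqP => [->|_]; first by rewrite sum_delta.
by rewrite big1 ?addr0.
Qed.

Lemma esum_act_sg e : esum_act (sg_aut e) = sgv e.
Proof.
apply/funext => v; apply/funext => a; rewrite /esum_act /sgv.
transitivity (\sum_l Posz (l == a) * (if e l then - v l else v l))%R.
  apply: eq_bigr => l _; rewrite sg_autE; case: (e l); rewrite ?esumV esum_gen //.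
  by rewrite mulrN mulNr.
exact: (sum_delta (sgv e v)).
Qed.

Lemma esum_act_pm s : esum_act (pm_aut s) = pmv s.
Proof.
apply/funext => v; apply/funext => a; rewrite /esum_act /pmv -[RHS]sum_delta.
apply: eq_bigr => l _; rewrite pm_autE esum_gen.
by rewrite -(inj_eq (@perm_inj _ s)) permKV.
Qed.

End ExponentSums.

(** * Aut(F_n) modulo the Magnus generators *)

Section MagnusQuotient.
Variable n : nat.
Notation F := (free_group 'I_n).
Implicit Types (i j k l : 'I_n) (f g c : aut F) (s t : {perm 'I_n}).

Definition magnus_closure : set (Out F) :=
  generated (conjugates (magnus_generators n)).

Lemma conjugates_stable (G : groupType) (T : set G) (g t : G) :
  conjugates T t -> conjugates T (g * t * g^-1).
Proof.
case=> h _ [u Tu <-]; exists (g * h) => //; exists u => //.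
by rewrite invgM !mulgA.
Qed.

Lemma sub_normal_closure (G : groupType) (T : set G) (t : G) :
  T t -> generated (conjugates T) t.
Proof.
move=> Tt; apply: sub_gen_smallest; exists 1 => //; exists t => //.
by rewrite mul1g invg1 mulg1.
Qed.

Fact magnus_normal :
  is_normal_subgroup [set f : aut F | magnus_closure (out_class f)]%classic.
Proof.
have [[c1 cM cV] cJ] : is_normal_subgroup magnus_closure.
  by apply: generated_normal => g t; exact: conjugates_stable.
have out1 : out_class (1 : aut F) = 1 by [].
have outV f : out_class f^-1 = (out_class f)^-1 by exact: projV.
split; first split=> /= [|f g hf hg|f hf] //=.
- by rewrite out_classM; exact: cM.
- by rewrite outV; exact: cV.
by move=> g f hf /=; rewrite !out_classM outV; exact: cJ.
Qed.

Definition magnus_kernel : normal_subgroup (aut F) :=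
  NormalSubgroup magnus_normal.

Notation "[ f ]" := (proj magnus_kernel f : quotient_group magnus_kernel)
  (at level 0, f at level 99).

Lemma projML f g : [f * g] = [f] * [g].
Proof. exact: projM. Qed.

Lemma mod_magnus c f : nset magnus_kernel c -> [c * f] = [f].
Proof.
move=> Nc; rewrite projML (_ : [c] = 1) ?mul1g //.
have [[_ _ NV] _] := nsetP magnus_kernel.
by apply/projP; rewrite mulg1; exact: NV.
Qed.

Lemma kernel_Mij i j (ij : i != j) : nset magnus_kernel (Mij ij).
Proof. by apply: sub_normal_closure; left; exists i, j, ij. Qed.

(** For k < j, M_ijk is the inverse of M_ikj. *)
Lemma kernel_Mijk i j k (ij : i != j) (ik : i != k) :
  j != k -> nset magnus_kernel (Mijk ij ik).
Proof.
have pos i' j' k' (ij' : i' != j') (ik' : i' != k') :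
    (j' < k')%N -> nset magnus_kernel (Mijk ij' ik').
  by move=> jk; apply: sub_normal_closure; right; exists i', j', k', ij', ik'.
rewrite neq_ltn => /orP[/pos //|/(pos _ _ _ ik ij)].
have [[_ _ NV] _] := nsetP magnus_kernel.
move=> /NV; congr (nset magnus_kernel _); apply: mulg1_eq; apply: aut_fgen_eq => l.
rewrite aut_mulE; have [->|li] := eqVneq l i; last by rewrite !Mijk_id.
rewrite MijkE autM MijkE.
have -> : Mijk ik ij (commutator (fgen j) (fgen k)) = commutator (fgen j) (fgen k).
  by rewrite /commutator !autM !autV !Mijk_id // eq_sym.
by rewrite /commutator !mulgA !(mulgK, mulgVK).
Qed.

(** The automorphism x_j |-> x_j x_i^(+1) or x_j x_i^(-1). *)
Definition tr_sgn (b : bool) i j : aut F :=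
  if b then (tr_aut i j)^-1 else tr_aut i j.

Lemma tr_sgnE b i j : i != j ->
  tr_sgn b i j (fgen j) = fgen j * (if b then (fgen i)^-1 else fgen i).
Proof.
move=> ij; case: b; last exact: tr_autE.
apply: (can_inj (autK (tr_aut i j))).
by rewrite -aut_mulE mulgV autM autV tr_autE // tr_aut_id // mulgK.
Qed.

Lemma tr_sgn_id b i j l : l != j -> tr_sgn b i j (fgen l) = fgen l.
Proof.
move=> lj; case: b; last exact: tr_aut_id.
apply: (can_inj (autK (tr_aut i j))).
by rewrite -aut_mulE mulgV tr_aut_id.
Qed.

(** Changing the sign of x_j turns multiplication by x_i on the right into
    multiplication on the left; the two differ by a conjugation of x_j by x_i. *)
Lemma kernel_sg_tr e i j : i != j ->
  [sg_aut e * tr_aut i j] = [tr_sgn (e i (+) e j) i j * sg_aut e].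
Proof.
move=> ij; have ji : j != i by rewrite eq_sym.
pose c : aut F := if e j then if e i then Mij ji else (Mij ji)^-1 else 1.
have Nc : nset magnus_kernel c.
  have [[N1 _ NV] _] := nsetP magnus_kernel; have := kernel_Mij ji.
  by rewrite /c; case: (e j); case: (e i) => // /NV.
have cE : c (fgen j) = if e j then if e i then fgen i * fgen j * (fgen i)^-1
    else (fgen i)^-1 * fgen j * fgen i else fgen j.
  rewrite /c; case: (e j) => //; case: (e i); first exact: MijE.
  exact: subst_gen_i.
have cid l : l != j -> c (fgen l) = fgen l.
  move=> lj; rewrite /c; case: (e j) => //; case: (e i); first exact: Mij_id.
  exact: subst_gen_l.
rewrite -[RHS](mod_magnus _ Nc); congr [_]; apply: aut_fgen_eq => l.
rewrite !aut_mulE; have [->|lj] := eqVneq l j; last first.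
  rewrite tr_aut_id // sg_autE.
  by case: (e l); rewrite ?autV tr_sgn_id // ?autV cid.
rewrite tr_autE // autM !sg_autE; case: (e j) cE => cE.
  rewrite autV tr_sgnE // addbT.
  by case: (e i) cE => /= cE; rewrite invgM !autM ?autV ?(cid i) // cE
    ?invgM ?invgK !mulgA ?mulgV ?mulVg ?mul1g.
by rewrite tr_sgnE // addbF autM cE; case: (e i); rewrite ?autV cid.
Qed.

Lemma elementary_relations_mod_magnus : elementary_relations
  (fun i j => [tr_aut i j]) (fun e => [sg_aut e]) (fun s => [pm_aut s]).
Proof.
split.
- move=> i j k l ij kl jk il; rewrite -!projML.
  have [kj li] : k != j /\ l != i by rewrite !(eq_sym _ j) !(eq_sym _ i).
  have [jl|jl] := eqVneq j l; last first.
    have lj : l != j by rewrite eq_sym.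
    congr [_]; apply: aut_fgen_eq => a; rewrite !aut_mulE.
    have [->|aj] := eqVneq a j.
      by rewrite [in LHS]tr_aut_id // tr_autE // autM !tr_aut_id.
    rewrite [in RHS]tr_aut_id //; have [->|al] := eqVneq a l.
      by rewrite tr_autE // autM !tr_aut_id.
    by rewrite !tr_aut_id.
  subst l; have [->//|ik] := eqVneq i k.
  have ji : j != i by rewrite eq_sym.
  (* Both sides multiply x_j, by x_i x_k and by x_k x_i. *)
  rewrite -[RHS](mod_magnus _ (kernel_Mijk ji jk ik)); congr [_].
  apply: aut_fgen_eq => a; rewrite !aut_mulE; have [->|aj] := eqVneq a j.
    rewrite (tr_autE kl) (tr_autE ij) autM (tr_autE ij) (tr_aut_id _ kj).
    rewrite autM (tr_autE kl) (tr_aut_id _ ij) autM autM MijkE !Mijk_id //.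
    by rewrite /commutator !mulgA !mulgVK.
  by rewrite !tr_aut_id // Mijk_id.
- move=> i j l ij jl il.
  rewrite -(projML (tr_aut i j)) -(projML (tr_aut i j)) -(projML (tr_aut j l)).
  congr [_].
  have [ji lj li] : [/\ j != i, l != j & l != i] by rewrite !(eq_sym l) (eq_sym j).
  apply: aut_fgen_eq => a; rewrite !aut_mulE; have [->|al] := eqVneq a l.
    rewrite (tr_autE jl) (tr_autE il) autM (tr_autE ij) (tr_aut_id _ lj).
    rewrite autM (tr_aut_id _ lj) (tr_aut_id _ ij) autM (tr_autE jl).
    by rewrite (tr_aut_id _ il) mulgA.
  rewrite !(@tr_aut_id _ _ l) //; have [->|aj] := eqVneq a j.
    by rewrite tr_autE // autM !(@tr_aut_id _ j l).
  by rewrite !tr_aut_id.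
- move=> i j ij; have ji : j != i by rewrite eq_sym.
  rewrite -(projML (pm_aut _)) -(projML (sg_aut _)) -(projML (tr_aut i j)).
  (* The product of three transvections and a sign on the right sends x_i to
     x_j x_i and x_j to x_i^-1 x_j x_i. *)
  rewrite -[RHS](mod_magnus _ (kernel_Mij ji)); congr [_].
  apply: aut_fgen_eq => a; rewrite !aut_mulE.
  have [->|ai] := eqVneq a i.
    rewrite tr_autE // (tr_aut_id _ ij) pm_autE tpermL sg1_autE (negPf ji).
    by rewrite tr_autE // autM MijE Mij_id // mulgVK.
  have [->|aj] := eqVneq a j.
    rewrite (tr_aut_id _ ji) (tr_autE ij) autM !pm_autE tpermR tpermL.
    rewrite autM !sg1_autE eqxx (negPf ji) autM autV (tr_aut_id _ ij) (tr_autE ij).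
    rewrite autM autM autV MijE (Mij_id _ ij).
    by rewrite !mulgA mulVg mul1g mulgVK.
  by rewrite !tr_aut_id // pm_autE tpermD 1?eq_sym // sg1_autE (negPf ai)
    tr_aut_id // Mij_id.
- move=> e e'; rewrite -projML; congr [_]; apply: aut_fgen_eq => l.
  rewrite aut_mulE !sg_autE; case: (e' l); rewrite ?autV sg_autE.
    by case: (e l); rewrite ?invgK.
  by rewrite addbF.
- move=> e i j ij; rewrite -projML kernel_sg_tr // projML /tr_sgn.
  by case: ifP => // _; congr (_ * _); exact: projV.
- move=> s t; rewrite -projML; congr [_]; apply: aut_fgen_eq => l.
  by rewrite aut_mulE !pm_autE permM.
- move=> s e; rewrite -!projML; congr [_]; apply: aut_fgen_eq => l.
  rewrite !aut_mulE pm_autE !sg_autE permK.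
  by case: (e l); rewrite ?autV pm_autE.
move=> s i j ij; rewrite -!projML; congr [_]; apply: aut_fgen_eq => l.
have sij : s i != s j by rewrite (inj_eq perm_inj).
rewrite !aut_mulE pm_autE; have [->|lj] := eqVneq l j.
  by rewrite !tr_autE // autM !pm_autE.
by rewrite !tr_aut_id ?(inj_eq perm_inj) // pm_autE.
Qed.

Lemma magnus_closure_IO : (magnus_closure `<=` IO n)%classic.
Proof.
have [IOs IOJ] := IO_normal n; apply: smallest_sub => // _ [g _ [t Tt <-]].
by apply: IOJ; exact: magnus_IO.
Qed.

(** The quotient acts on Z^n since the Magnus generators act trivially. *)
Definition mod_act (q : quotient_group magnus_kernel) v := esum_act (generic_quotient.repr q) v.

Lemma mod_actE f : mod_act [f] = esum_act f.
Proof.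
apply/funext => v; rewrite /mod_act; set f' := generic_quotient.repr _.
have /projP/magnus_closure_IO ff' : proj magnus_kernel f' = proj magnus_kernel f.
  exact: repr_proj.
by rewrite -[in RHS](mulVKg f' f) esum_actM (esum_act_IO _ ff').
Qed.

Lemma elementary_action_mod_magnus : elementary_action
  (fun i j => [tr_aut i j]) (fun e => [sg_aut e]) (fun s => [pm_aut s]) mod_act.
Proof.
split=> [v|q r v|i j ij|e|s].
- by rewrite mod_actE esum_act_IO // => a; exact: out_act1.
- rewrite -[q]repr_proj -[r]repr_proj -projML !mod_actE; exact: esum_actM.
- by rewrite mod_actE; exact: esum_act_tr.
- by rewrite mod_actE; exact: esum_act_sg.
- by rewrite mod_actE; exact: esum_act_pm.
Qed.

Lemma IO_magnus_closure : (IO n `<=` magnus_closure)%classic.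
Proof.
move=> phi; have [f ->] := out_classP phi => fIO.
suff /projP : proj magnus_kernel f = proj magnus_kernel 1.
  have [[_ _ NV] _] := nsetP magnus_kernel.
  by rewrite mulg1 => /NV; rewrite invgK.
pose P := elementary (fun i j => [tr_aut i j]) (fun e => [sg_aut e])
  (fun s => [pm_aut s]) [set: 'I_n]%SET.
have pf : products P [f].
  elim: (Nielsen_generation f) => [|a g ea _ IH]; first exact: products1.
  rewrite projML; apply: productsM => //.
  case: ea => [i j iI jI ij|e eI|s sI].
  - exact: (elementary_tr (fun i j => [tr_aut i j])).
  - exact: (elementary_sg _ (fun e => [sg_aut e])).
  - exact: (elementary_pm _ _ (fun s => [pm_aut s])).
apply: (elementary_faithful elementary_relations_mod_magnus
          elementary_action_mod_magnus pf) => v.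
by rewrite mod_actE esum_act_IO.
Qed.

End MagnusQuotient.

Theorem theorem4 (n : nat) (n_ge1 : (1 <= n)%N) :
  normally_generated_by (IO n) (magnus_generators n).
Proof.
split; [exact: IO_normal|exact: magnus_IO|].
by apply/seteqP; split; [exact: IO_magnus_closure|exact: magnus_closure_IO].
Qed.
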